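(* Consider the closed-loop system $\dot{x}=\tilde{A}(\theta)x$, $\theta=(\phi_1(x),\phi_2(x))$, described in the context, with $K(\theta)=\varrho_K(\theta,\bar{t}_\theta)$, where $\bar{t}_\theta$ is a real number such that $\eta(\theta,\bar{t}_\theta)=0$. Let $\mathcal{D}$ be a subset of the state space $\mathbb{R}^2$ with $0\in\mathcal{D}$, put $$\mathcal{E}=\{\theta\in\mathbb{R}^2:\exists x\in\mathcal{D}:\ \theta_1=\phi_1(x),\ \theta_2=\phi_2(x)\},\qquad \mathcal{F}=\{\omega\in\mathbb{R}^2:\exists x\in\mathcal{D}:\ \omega_1=\psi_1(x),\ \omega_2=\psi_2(x)\},$$ and assume: 1) there is $L_A$ such that $\Vert\tilde{A}(\theta)-\tilde{A}(\theta')\Vert\le L_A\Vert\theta-\theta'\Vert$ for all $\theta,\theta'\in\mathcal{E}$; 2) there exist constants $m\ge 1$ and $\lambda>0$ such that, for each fixed $\bar\theta\in\mathcal{E}$, any solution of $\dot{x}=\tilde{A}(\bar\theta)x$ satisfies $\Vert x(t)\Vert\le m e^{-\lambda t}\Vert x(0)\Vert$ for all $t\ge 0$; 3) with these $L_A,m,\lambda$, $\Vert\dot\theta\Vert<\dfrac{\lambda^2}{4L_A m\log(m)}$ for all $\dot\theta\in\mathcal{F}$. Then $0$ is exponentially stable for the closed-loop system, and the set $\mathcal{L}\subset\mathcal{D}$ defined in the context is a conservative estimate of the attraction domain (i.e. it is contained in the domain of attraction of $0$).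
   Context: Model. Let $\kappa_\alpha,\kappa_q,M,a_n,b_n,c_n,d_n,a_m,b_m,c_m,d_m$ be known real constants (aerodynamic coefficients and Mach number of a missile), let the state be $x=(\alpha,q)^\top\in\mathbb{R}^2$, and consider $$\dot\alpha=\kappa_\alpha M((a_n\alpha^2+b_n\alpha+c_n)\alpha+d_n\delta)+q,\qquad \dot q=\kappa_q M((a_m\alpha^2+b_m\alpha+c_m)\alpha+d_m\delta),$$ with control input $\delta$. Set $\phi_1(x)=\kappa_\alpha M(a_n\alpha^2+b_n\alpha+c_n)$, $\phi_2(x)=\kappa_q M(a_m\alpha^2+b_m\alpha+c_m)$, $\theta=(\theta_1,\theta_2)=(\phi_1(x),\phi_2(x))$, $$A(\theta)=\begin{bmatrix}\theta_1&1\\ \theta_2&0\end{bmatrix},\quad B=\begin{bmatrix}\kappa_\alpha M d_n\\ \kappa_q M d_m\end{bmatrix},\quad C=[\,1\ \ 0\,].$$ With the static output feedback $\delta=K(\theta)\alpha$, where $K(\theta)$ is a scalar gain, the closed-loop system is $\dot x=\tilde A(\theta)x$ with $\tilde A(\theta)=A(\theta)+BK(\theta)C$ and $\theta=(\phi_1(x),\phi_2(x))$ along trajectories. Let $\dot\alpha(x)=\phi_1(x)\alpha+q+\kappa_\alpha M d_nK(\theta)\alpha$ be the first component of the closed-loop vector field, and define $\psi_1(x)=\kappa_\alpha M(2a_n\alpha+b_n)\dot\alpha(x)$ and $\psi_2(x)=\kappa_q M(2a_m\alpha+b_m)\dot\alpha(x)$, so that $\dot\theta_i=\psi_i(x)$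 along closed-loop trajectories. The gain. Let $\lambda_0>0$ be a fixed design constant, and let $s^2+p_1s+p_2$ be the characteristic polynomial of $\tilde A(\theta)$, so $p_1=-KM\kappa_\alpha d_n-\theta_1$, $p_2=-KM\kappa_q d_m-\theta_2$. The inequalities to be satisfied by $K$, for given $\theta$, are $$p_1^2-4p_2<0,\qquad p_1>2\lambda_0 .\qquad ( * )$$ The polynomials $\eta(\theta,t)$ and $\varrho_K(\theta,t)$ are obtained as follows, treating $\theta$ as a parameter. Put $f_1=4p_2-p_1^2$, $f_2=p_1-2\lambda_0$ and, for generic (random) real constants $\alpha_1,\beta_1,\gamma_1,\gamma_2,\delta_1,\delta_2$, $$H(K,v,w)=\alpha_1(K-\beta_1)^2+\sum_{k=1}^2\gamma_k(w_k-\delta_k)^2+\sum_{k=1}^2v_k(w_k^2f_k-1).$$ Let $\mathcal{I}$ be the (generically zero dimensional) ideal generated by all the partial derivatives of $H$ with respect to $K,v_1,v_2,w_1,w_2$, let $s(K,v,w)$ be a polynomial taking distinct values at distinct complex zeros of $\mathcal{I}$, and compute the Groebner basis of the ideal generated by $\mathcal{I}$ and $t-s(K,v,w)$ with respect to a lex ordering in which $t$ is the smallest variable. It has the form consisting of $\eta(\theta,t)$ together with one polynomial of the form (variable $-$ polynomial in $t$) for each of the variables $K,v_1,v_2,w_1,w_2$; $\varrho_K$ is defined by the element $K-\varrho_K(\theta,t)$. For each $\theta$ and each real $\bar t$ with $\eta(\theta,\bar t)=0$, the value $K=\varrho_K(\theta,\bar t)$ satisfies $( * )$. The set $\mathcal{L}$.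 For $\theta\in\mathcal{E}$ let $P(\theta)=\int_0^\infty e^{\tau\tilde A(\theta)^\top}e^{\tau\tilde A(\theta)}\,d\tau$ (positive definite), and let $L_P>0$ be a constant with $\Vert P(\theta)-P(\theta')\Vert\le L_P\Vert\theta-\theta'\Vert$ for all $\theta,\theta'\in\mathcal{E}$. Let $\mathcal{H}=\{x\in\mathcal{D}:\Vert(\psi_1(x),\psi_2(x))\Vert<L_P^{-1}\}$. Let $c>0$ be the largest constant such that $\mathcal{W}(\theta)=\{x\in\mathbb{R}^2:x^\top P(\theta)x<c\}$ is a subset of $\mathcal{H}$ for all $\theta\in\mathcal{E}$. Then $\mathcal{L}=\bigcap_{\theta\in\mathcal{E}}\mathcal{W}(\theta)$. *)

(* Defs.v *)
(* Only the canonical structures and coercions of mpoly and complex are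
   imported: the notations of mpoly clash with those of MathComp-Analysis. *)
From mathcomp Require Import all_boot all_order all_algebra all_fingroup.
From mathcomp Require Import all_classical all_reals all_analysis.
From mathcomp.multinomials Require Import(canonicals, coercions) mpoly.
From mathcomp Require Import(canonicals, coercions) complex.

Set Implicit Arguments.
Unset Strict Implicit.
Unset Printing Implicit Defensive.

Import Order.TTheory GRing.Theory Num.Theory.
Import numFieldNormedType.Exports.

Local Open Scope classical_set_scope.
Local Open Scope ring_scope.

(* Euclidean norm and the matrix norm it induces; the library's norm `|A| on
   matrices is the largest modulus of an entry. *)
Definition enorm (R : realType) (n : nat) (v : 'cV[R]_n) : R :=
  Num.sqrt (\sum_i v i 0 ^+ 2).

Definition opnorm (R : realType) (n : nat) (A : 'M[R]_n) : R :=
  sup [set enorm (A *m v) | v in [set v : 'cV[R]_n | enorm v <= 1]].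

Definition cv2 (R : realType) (a b : R) : 'cV[R]_2 := \col_i [:: a; b]`_i.

Definition mexp (R : realType) (A : 'M[R]_2) : 'M[R]_2 :=
  limn (fun N => \sum_(k < N) (k`!%:R)^-1 *: A ^+ k).

(* x solves x' = f(x) on [0, T[, with a one-sided derivative at 0. *)
Definition solution (R : realType) (f : 'cV[R]_2 -> 'cV[R]_2) (T : \bar R)
    (x : R -> 'cV[R]_2) : Prop :=
  forall t : R, 0 <= t -> (t%:E < T)%E ->
    (u - t)^-1 *: (x u - x t)
      @[u --> within [set u | 0 <= u /\ (u%:E < T)%E] t^'] --> f (x t).

(* f is not assumed to be regular, so that existence of a global solution is
   part of the definition, and the estimate is required of all solutions,
   including those that are only defined on a bounded time interval. *)
Definition exp_stable (R : realType) (f : 'cV[R]_2 -> 'cV[R]_2) : Prop :=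
  exists r k mu : R, [/\ 0 < r, 0 < k, 0 < mu &
    forall x0, enorm x0 < r ->
      (exists x, solution f +oo%E x /\ x 0 = x0) /\
      (forall (T : \bar R) x, solution f T x -> x 0 = x0 ->
         forall t, 0 <= t -> (t%:E < T)%E ->
           enorm (x t) <= k * expR (- mu * t) * enorm x0)].

(* The solution from x0 is unique, defined for all t >= 0, and tends to 0. *)
Definition attraction_domain (R : realType) (f : 'cV[R]_2 -> 'cV[R]_2) :
    set 'cV[R]_2 :=
  [set x0 | exists x, [/\ solution f +oo%E x, x 0 = x0,
    x t @[t --> +oo] --> (0 : 'cV[R]_2) &
    forall (T : \bar R) y, solution f T y -> y 0 = x0 ->
      forall t, 0 <= t -> (t%:E < T)%E -> y t = x t]].

Record missile (R : realType) := Missile {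
  kappa_alpha : R; kappa_q : R; mach : R;
  a_n : R; b_n : R; c_n : R; d_n : R;
  a_m : R; b_m : R; c_m : R; d_m : R }.

Section Model.
Variables (R : realType) (p : missile R).
Implicit Types (x theta : 'cV[R]_2) (K : 'cV[R]_2 -> R).

(* The state is x = (alpha, q). *)
Definition phi x : 'cV[R]_2 :=
  let alpha := x 0 0 in
  cv2 (kappa_alpha p * mach p * (a_n p * alpha ^+ 2 + b_n p * alpha + c_n p))
      (kappa_q p * mach p * (a_m p * alpha ^+ 2 + b_m p * alpha + c_m p)).

Definition Amx theta : 'M[R]_2 :=
  \matrix_(i, j) (nth [::] [:: [:: theta 0 0; 1]; [:: theta 1 0; 0]] i)`_j.

Definition Bmx : 'cV[R]_2 :=
  cv2 (kappa_alpha p * mach p * d_n p) (kappa_q p * mach p * d_m p).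

Definition Cmx : 'rV[R]_2 := \row_j [:: 1; 0]`_j.

Definition Acl K theta : 'M[R]_2 := Amx theta + Bmx *m (K theta)%:M *m Cmx.

Definition closed_loop K x : 'cV[R]_2 := Acl K (phi x) *m x.

(* The rate of change of theta = phi x along the closed-loop trajectories. *)
Definition psi K x : 'cV[R]_2 :=
  let alpha := x 0 0 in
  let q := x 1 0 in
  let dalpha := phi x 0 0 * alpha + q
    + kappa_alpha p * mach p * d_n p * K (phi x) * alpha in
  cv2 (kappa_alpha p * mach p * (2 * a_n p * alpha + b_n p) * dalpha)
      (kappa_q p * mach p * (2 * a_m p * alpha + b_m p) * dalpha).

Definition theta_set (D : set 'cV[R]_2) : set 'cV[R]_2 := phi @` D.

Definition rate_set K (D : set 'cV[R]_2) : set 'cV[R]_2 := psi K @` D.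

Definition Plyap K theta : 'M[R]_2 :=
  \matrix_(i, j)
    \int[lebesgue_measure]_(tau in `[0, +oo[)
      (mexp (tau *: (Acl K theta)^T) *m mexp (tau *: Acl K theta)) i j.

Definition Hset K (D : set 'cV[R]_2) (LP : R) : set 'cV[R]_2 :=
  [set x | D x /\ enorm (psi K x) < LP^-1].

Definition Wset K (c : R) theta : set 'cV[R]_2 :=
  [set x | (x^T *m Plyap K theta *m x) 0 0 < c].

Definition admissible_level K (D : set 'cV[R]_2) (LP c : R) : Prop :=
  forall theta, theta_set D theta -> Wset K c theta `<=` Hset K D LP.

Definition largest_level K (D : set 'cV[R]_2) (LP c : R) : Prop :=
  [/\ 0 < c, admissible_level K D LP c &
      forall c', admissible_level K D LP c' -> c' <= c].

Definition Lset K (D : set 'cV[R]_2) (c : R) : set 'cV[R]_2 :=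
  [set x | forall theta, theta_set D theta -> Wset K c theta x].

End Model.

Section Groebner.
Variables (R : fieldType) (n : nat).
Local Notation mpol := (mpoly.mpoly n R).
Local Notation monom := (mpoly.multinom n).

Definition ideal_of (gs : seq mpol) : set mpol :=
  [set f | exists c : nat -> mpol, f = \sum_(i < size gs) c i * gs`_i].

(* Lex order for which the variables, from largest to smallest, are those of
   indices ord 0, ord 1, ... *)
Definition lex_lt (ord : {perm 'I_n}) (m m' : monom) : bool :=
  [exists j : 'I_n, (m (ord j) < m' (ord j))%N &&
    [forall i : 'I_n, (i < j)%N ==> (m (ord i) == m' (ord i))]].

Definition is_lm (ord : {perm 'I_n}) (f : mpol) (m : monom) : Prop :=
  m \in mpoly.msupp f /\
  forall m', m' \in mpoly.msupp f -> m' != m -> lex_lt ord m' m.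

Definition mdivides (m m' : monom) : Prop := forall i, (m i <= m' i)%N.

Definition groebner_basis (ord : {perm 'I_n}) (J : set mpol) (G : seq mpol) :
    Prop :=
  (forall g, g \in G -> J g) /\
  (forall f, J f -> f != 0 -> exists g m m',
     [/\ g \in G, is_lm ord g m, is_lm ord f m' & mdivides m m']).

Definition reduced_groebner_basis (ord : {perm 'I_n}) (J : set mpol)
    (G : seq mpol) : Prop :=
  [/\ groebner_basis ord J G,
      uniq G,
      (forall g, g \in G -> exists2 m, is_lm ord g m & mpoly.mcoeff m g = 1) &
      forall g h m m', g \in G -> h \in G -> h != g ->
        m \in mpoly.msupp g -> is_lm ord h m' -> ~ mdivides m' m].

End Groebner.

(* The constants alpha_1, beta_1, (gamma_1, gamma_2), (delta_1, delta_2). *)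
Record generic_constants (R : realType) := GenericConstants {
  g_alpha : R; g_beta : R; g_gamma : 'I_2 -> R; g_delta : 'I_2 -> R }.

Section Gain.
Variables (R : realType) (p : missile R) (lambda0 : R).
Variables (g : generic_constants R) (theta : 'cV[R]_2).
Local Notation mpol := (mpoly.mpoly 5 R).
Local Notation mpolt := (mpoly.mpoly 6 R).
Local Notation cst := (@mpoly.mpolyC 5 R).
Local Notation var5 i := (mpoly.mpolyX R (mpoly.mnm1 (i : 'I_5))).
Local Notation var6 i := (mpoly.mpolyX R (mpoly.mnm1 (i : 'I_6))).

(* Variables 0, ..., 4 are K, v_1, v_2, w_1, w_2, and variable 5 is t. *)
Definition Kvar : mpol := var5 0.
Definition vvar (k : 'I_2) : mpol := var5 (inord (1 + k)).
Definition wvar (k : 'I_2) : mpol := var5 (inord (3 + k)).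

(* s^2 + p1 s + p2 is the characteristic polynomial of the closed-loop matrix
   with gain K. *)
Definition p1 : mpol :=
  - (Kvar * cst (mach p * kappa_alpha p * d_n p)) - cst (theta 0 0).
Definition p2 : mpol :=
  - (Kvar * cst (mach p * kappa_q p * d_m p)) - cst (theta 1 0).

Definition fpol (k : 'I_2) : mpol :=
  [:: 4 * p2 - p1 ^+ 2; p1 - cst (2 * lambda0)]`_k.

Definition Hpol : mpol :=
  cst (g_alpha g) * (Kvar - cst (g_beta g)) ^+ 2
  + \sum_k cst (g_gamma g k) * (wvar k - cst (g_delta g k)) ^+ 2
  + \sum_k vvar k * (wvar k ^+ 2 * fpol k - 1).

Definition critical_eqs : seq mpol :=
  [seq mpoly.mderiv i Hpol | i <- enum 'I_5].

Definition ceval (z : 'I_5 -> complex.complex R) (f : mpol) :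
    complex.complex R :=
  mpoly.mmap (fun a : R => complex.Complex a 0) z f.

(* All elements of the ideal generated by critical_eqs vanish at the common
   zeros of its generators. *)
Definition czeros : set ('I_5 -> complex.complex R) :=
  [set z | forall f, f \in critical_eqs -> ceval z f = 0].

Definition extended_ideal (s : mpol) : set mpolt :=
  ideal_of (rcons [seq mpoly.mwiden f | f <- critical_eqs]
                  (var6 ord_max - mpoly.mwiden s)).

Definition poly_in_t (h : {poly R}) : mpolt :=
  (map_poly (@mpoly.mpolyC 6 R) h).[var6 ord_max].

(* For the fixed parameter theta: the critical ideal is zero dimensional, s
   separates its complex zeros, and the reduced lex Groebner basis of the
   extended ideal is { eta(t) } U { X_i - rho_i(t) : i = 0, ..., 4 }.  The
   polynomial called varrho_K is rho 0. *)
Definition gain_polynomials (ord : {perm 'I_6}) (s : mpol) (eta : {poly R})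
    (rho : 'I_5 -> {poly R}) : Prop :=
  [/\ finite_set czeros,
      (forall z z', czeros z -> czeros z' -> ceval z s = ceval z' s -> z = z') &
      reduced_groebner_basis ord (extended_ideal s)
        (poly_in_t eta ::
         [seq mpoly.mwiden (var5 i) - poly_in_t (rho i) | i <- enum 'I_5])].

End Gain.

(* Main.v *)
Require Import Defs.
From mathcomp Require Import all_boot all_order all_algebra all_fingroup.
From mathcomp Require Import all_classical all_reals all_analysis.
From mathcomp.multinomials Require mpoly.
From mathcomp Require Import measurable_realfun.
From mathcomp Require Import ring lra.
Import Order.TTheory GRing.Theory Num.Theory.
Import numFieldNormedType.Exports.
Set Implicit Arguments.
Unset Strict Implicit.
Unset Printing Implicit Defensive.
Local Open Scope classical_set_scope.
Local Open Scope ring_scope.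

(** Near 0 the closed-loop vector field is A (phi 0) x + O(|x|^2), and
    A (phi 0) is exponentially stable since 0 lies in D; exponential stability
    of 0 is therefore stability in the first approximation. Both this and the
    second part rest on perturbed_decay: a linear equation x' = A x with
    |exp (t A)| <= m exp (- l t) keeps the rate l - m eps under perturbations of
    size eps |x|, because the norm sup_t exp (l t) |exp (t A) v| contracts along
    the flow of A without the constant m.

    For the attraction domain, let x be a solution from a point of L, put
    theta = phi x, so that theta' = psi x, and V x = x^T P (phi x) x. As long as
    x stays in D with V x < c, two things happen.
    - P theta solves the Lyapunov equation A^T P + P A = -1 (gramian_lyapunov),
      so V changes at rate at most (LP |psi x| - 1) |x|^2, and |psi x| < 1 / LP
      since x belongs to W theta. Hence V does not increase, and a limit
      of points x s still lies in one of the open sets W (phi (x s)), which are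
      contained in D: x never leaves D (trapped).
    - theta varies slowly, so x' = A (theta t) x can be compared, on intervals
      of a suitable length h, with the equation frozen at the midpoint; over each
      such interval the decay beats the constant m (slowly_varying_decay). This
      gives |x t| <= m exp (- l t / 4) |x 0|.

    The second estimate also confines x to a bounded part of D, on which the
    vector field is Lipschitz. Existence and uniqueness can thus be read off a
    globally Lipschitz extension of it (lipschitz_field_extension), for which
    Picard iteration converges on the whole half-line
    (lipschitz_global_solution).

    Neither V nor the adapted norm is differentiable along x, so all estimates
    are phrased with one-sided Dini derivatives (dini_nonincreasing). *)

(** * The Euclidean plane *)

Section Plane.
Variable R : realType.
Implicit Types (u v w : 'cV[R]_2) (A B : 'M[R]_2).

Lemma ord2P (i : 'I_2) : i = 0 \/ i = 1.
Proof.
by case: i => [[|[|//]] h]; [left|right]; apply/val_inj.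
Qed.

Lemma cv2P u v : u 0 0 = v 0 0 -> u 1 0 = v 1 0 -> u = v.
Proof.
move=> e0 e1; apply/colP => i.
by case: (ord2P i) => ->.
Qed.

Lemma sum2 (V : nmodType) (F : 'I_2 -> V) : \sum_i F i = F 0 + F 1.
Proof. by rewrite big_ord_recl big_ord1; congr (_ + F _); apply/val_inj. Qed.

Lemma mulmx2E (A : 'M[R]_2) (v : 'cV[R]_2) i :
  (A *m v) i 0 = A i 0 * v 0 0 + A i 1 * v 1 0.
Proof. by rewrite mxE sum2. Qed.

Lemma enormE v : enorm v = Num.sqrt (v 0 0 ^+ 2 + v 1 0 ^+ 2).
Proof. by rewrite /enorm sum2. Qed.

Lemma enorm_ge0 v : 0 <= enorm v.
Proof. exact: sqrtr_ge0. Qed.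

Lemma enorm_sqr v : enorm v ^+ 2 = v 0 0 ^+ 2 + v 1 0 ^+ 2.
Proof. by rewrite enormE sqr_sqrtr// addr_ge0// sqr_ge0. Qed.

Lemma enorm0 : enorm (0 : 'cV[R]_2) = 0.
Proof. by rewrite enormE !mxE expr0n addr0 sqrtr0. Qed.

Lemma enorm_eq0 v : enorm v = 0 -> v = 0.
Proof.
move=> v0; have := enorm_sqr v; rewrite v0 expr0n/= => /esym/eqP.
rewrite paddr_eq0 ?sqr_ge0// !sqrf_eq0 => /andP[/eqP a /eqP b].
by apply: cv2P; rewrite mxE.
Qed.

Lemma enormZ (a : R) v : enorm (a *: v) = `|a| * enorm v.
Proof.
apply/eqP; rewrite -(eqrXn2 (n := 2))// ?mulr_ge0 ?enorm_ge0//.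
by rewrite exprMn !enorm_sqr real_normK ?num_real// !mxE; apply/eqP; ring.
Qed.

Lemma enormN v : enorm (- v) = enorm v.
Proof. by rewrite -scaleN1r enormZ normrN1 mul1r. Qed.

Lemma enormB v w : enorm (v - w) = enorm (w - v).
Proof. by rewrite -opprB enormN. Qed.

Lemma cauchy_schwarz2 v w :
  v 0 0 * w 0 0 + v 1 0 * w 1 0 <= enorm v * enorm w.
Proof.
apply: (le_trans (ler_norm _)).
rewrite -(ler_sqr (x := `|_|)) ?nnegrE ?mulr_ge0 ?enorm_ge0//.
rewrite exprMn !enorm_sqr real_normK ?num_real//.
have := sqr_ge0 (v 0 0 * w 1 0 - v 1 0 * w 0 0); nra.
Qed.

Lemma enormD v w : enorm (v + w) <= enorm v + enorm w.
Proof.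
rewrite -ler_sqr ?nnegrE ?addr_ge0 ?enorm_ge0//.
have cs := cauchy_schwarz2 v w.
rewrite [leRHS]sqrrD !enorm_sqr !mxE; lra.
Qed.

Lemma enorm_sub v w : enorm v - enorm w <= enorm (v - w).
Proof. by rewrite lerBlDr (le_trans _ (enormD _ _))// subrK. Qed.

Lemma coord_le_enorm v i : `|v i 0| <= enorm v.
Proof.
rewrite -ler_sqr ?nnegrE ?enorm_ge0// enorm_sqr real_normK ?num_real//.
by case: (ord2P i) => ->; rewrite ?lerDl ?lerDr sqr_ge0.
Qed.

Lemma enorm_le_coord v : enorm v <= `|v 0 0| + `|v 1 0|.
Proof.
rewrite -ler_sqr ?nnegrE ?addr_ge0 ?enorm_ge0//.
rewrite [leRHS]sqrrD enorm_sqr !real_normK ?num_real//.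
have := mulr_ge0 (normr_ge0 (v 0 0)) (normr_ge0 (v 1 0)); lra.
Qed.

Lemma norm_le_enorm v : `|v| <= enorm v.
Proof.
rewrite /Num.norm/= mx_normrE; apply: bigmax_le => [|[i j] _/=].
  exact: enorm_ge0.
by rewrite ord1 coord_le_enorm.
Qed.

Lemma coord_le_norm v i : `|v i 0| <= `|v|.
Proof.
rewrite [leRHS]/Num.norm/= mx_normrE.
by apply: (@le_bigmax _ _ _ _ (fun ij => `|v ij.1 ij.2|) (i, 0)).
Qed.

Lemma enorm_le_norm v : enorm v <= 2 * `|v|.
Proof.
apply: (le_trans (enorm_le_coord v)).
by rewrite mulr2n mulrDl mul1r lerD// coord_le_norm.
Qed.

Lemma enorm_mulmx_bounded A :
  exists2 C, 0 <= C & forall v, enorm (A *m v) <= C * enorm v.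
Proof.
exists (`|A 0 0| + `|A 0 1| + (`|A 1 0| + `|A 1 1|)).
  by rewrite !addr_ge0.
move=> v; apply: (le_trans (enorm_le_coord _)); rewrite !mulmx2E.
have H (a b : R) : `|a * v 0 0 + b * v 1 0| <= (`|a| + `|b|) * enorm v.
  rewrite (le_trans (ler_normD _ _))// !normrM mulrDl.
  by rewrite lerD// ler_wpM2l// coord_le_enorm.
by rewrite mulrDl lerD.
Qed.

Lemma opnorm_has_sup A :
  has_sup [set enorm (A *m v) | v in [set v : 'cV[R]_2 | enorm v <= 1]].
Proof.
split.
  by exists (enorm (A *m 0)); exists 0 => //=; rewrite enorm0.
have [C C0 AC] := enorm_mulmx_bounded A.
exists C => _ [v /= v1 <-]; apply: (le_trans (AC v)).
by rewrite -[leRHS]mulr1 ler_wpM2l.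
Qed.

Lemma opnorm_ge0 A : 0 <= opnorm A.
Proof.
apply: (le_trans (enorm_ge0 (A *m 0))).
by apply: sup_ubound; [exact: (opnorm_has_sup A).2|exists 0 => //=; rewrite enorm0].
Qed.

Lemma enorm_mulmx A v : enorm (A *m v) <= opnorm A * enorm v.
Proof.
have [/enorm_eq0 ->|v0] := eqVneq (enorm v) 0.
  by rewrite mulmx0 enorm0 mulr0.
have vp : 0 < enorm v by rewrite lt_neqAle eq_sym v0 enorm_ge0.
rewrite -ler_pdivrMr// mulrC.
have -> : (enorm v)^-1 * enorm (A *m v) = enorm (A *m ((enorm v)^-1 *: v)).
  by rewrite -scalemxAr enormZ ger0_norm// invr_ge0 enorm_ge0.
apply: sup_ubound; first exact: (opnorm_has_sup A).2.
exists ((enorm v)^-1 *: v) => //=.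
by rewrite enormZ ger0_norm ?invr_ge0 ?enorm_ge0// mulVf.
Qed.

Definition bilin A v w : R := (v^T *m A *m w) 0 0.

Lemma bilinE A v w : bilin A v w =
  v 0 0 * (A *m w) 0 0 + v 1 0 * (A *m w) 1 0.
Proof. by rewrite /bilin -mulmxA mxE sum2 !mxE. Qed.

Lemma bilin_le A v w : bilin A v w <= opnorm A * (enorm v * enorm w).
Proof.
rewrite bilinE; apply: (le_trans (cauchy_schwarz2 _ _)).
by rewrite mulrCA ler_wpM2l ?enorm_ge0 ?enorm_mulmx.
Qed.

Lemma quad_diff A v w : bilin A v v - bilin A w w <=
  opnorm A * (enorm (v - w) * (enorm v + enorm w)).
Proof.
have -> : bilin A v v - bilin A w w = bilin A v (v - w) + bilin A (v - w) w.
  by rewrite !bilinE !mulmx2E !mxE; ring.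
apply: (le_trans (lerD (bilin_le _ _ _) (bilin_le _ _ _))).
lra.
Qed.

Lemma bilinBl A B v w : bilin (A - B) v w = bilin A v w - bilin B v w.
Proof. by rewrite !bilinE !mulmx2E !mxE; ring. Qed.

(** Here z is a point shortly after v on a curve with velocity w, and r its
    distance from the tangent: all terms that contain r or z - v are o(h). *)
Lemma quad_expansion A (h : R) v w z :
  let r := z - v - h *: w in
  bilin A z z - bilin A v v = h * (bilin A v w + bilin A w v) +
    (bilin A v r + bilin A r v + bilin A (z - v) (z - v)).
Proof. by move=> r; rewrite /r !bilinE !mulmx2E !mxE; ring. Qed.

End Plane.

(** * One-sided differential inequalities *)

Section Dini.
Variable R : realType.

Lemma near_rightP (t : R) (P : R -> Prop) :
  (\forall u \near t^'+, P u) <->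
  exists2 d, 0 < d & forall u, t < u < t + d -> P u.
Proof.
split=> [[d /= d0 dP]|[d d0 dP]].
  exists d => // u /andP[tu ud]; apply: dP => //=.
  by rewrite ltr0_norm ?subr_lt0// opprB ltrBlDl.
exists d => //= u /= tud tu; apply: dP; rewrite tu/=.
by move: tud; rewrite ltr0_norm ?subr_lt0// opprB ltrBlDl.
Qed.

Lemma near_leftP (t : R) (P : R -> Prop) :
  (\forall u \near t^'-, P u) <->
  exists2 d, 0 < d & forall u, t - d < u < t -> P u.
Proof.
split=> [[d /= d0 dP]|[d d0 dP]].
  exists d => // u /andP[tu ud]; apply: dP => //=.
  by rewrite gtr0_norm ?subr_gt0// ltrBlDl -ltrBlDr.
exists d => //= u /= tud ut; apply: dP; rewrite ut andbT.
by move: tud; rewrite gtr0_norm ?subr_gt0// ltrBlDl -ltrBlDr.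
Qed.

(** Induction along a real interval: the supremum of the initial segments on
    which P holds can be neither interior nor excluded. *)
Lemma real_induction (a b : R) (P : R -> Prop) :
  P a ->
  (forall t, a <= t -> t < b -> (forall s, a <= s -> s <= t -> P s) ->
     \forall u \near t^'+, P u) ->
  (forall t, a < t -> t <= b -> (forall s, a <= s -> s < t -> P s) -> P t) ->
  forall t, a <= t -> t <= b -> P t.
Proof.
move=> Pa Pr Pl t0 at0 t0b.
pose S := [set t | [/\ a <= t, t <= b & forall s, a <= s -> s <= t -> P s]].
have Sa : S a.
  split=> //; first exact: le_trans at0 t0b.
  by move=> s as_ sa; have -> : s = a by apply/le_anti; rewrite as_ sa.
have Sub : has_ubound S by exists b => t [].
pose c := sup S.
have ac : a <= c by apply: sup_ubound.
have cb : c <= b by apply: sup_le_ub; [exists a|move=> t []].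
have Pc s : a <= s -> s < c -> P s.
  move=> as_ sc; have [t [_ _ tP] st] := sup_gt (ex_intro _ _ Sa) sc.
  exact: tP (ltW st).
have Pcc : P c.
  by move: ac; rewrite le_eqVlt => /predU1P[<- //|ac]; exact: Pl.
have Pc' s : a <= s -> s <= c -> P s.
  by move=> as_; rewrite le_eqVlt => /predU1P[->//|]; exact: Pc.
have [bc|cb'] := leP b c; first by apply: Pc' => //; exact: le_trans bc.
have /near_rightP[d d0 dP] := Pr _ ac cb' Pc'.
pose e := Num.min (c + d / 2) b.
have ce : c < e by rewrite /e lt_min cb' andbT ltrDl divr_gt0.
suff : S e by move=> Se; have := sup_ubound Sub Se; rewrite leNgt ce.
split; [exact: le_trans (ltW ce)|by rewrite /e ge_min lexx orbT|].
move=> s as_ se; have [sc|cs] := leP s c; first exact: Pc'.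
apply: dP; rewrite cs/=; apply: (le_lt_trans se).
by rewrite /e gt_min ltrD2l; apply/orP; left; lra.
Qed.

(** A function that is left lower semicontinuous cannot increase if its upper
    right derivative is nowhere positive: with any slope e > 0 to spare, the set
    where w t <= w a + e (t - a) is closed from the left and open to the
    right. *)
Lemma dini_nonincreasing (w : R -> R) (a b : R) : a <= b ->
  (forall t, a < t -> t <= b -> forall e, 0 < e ->
     \forall s \near t^'-, w t <= w s + e) ->
  (forall t, a <= t -> t < b -> forall e, 0 < e ->
     \forall u \near t^'+, w u <= w t + e * (u - t)) ->
  w b <= w a.
Proof.
move=> ab wl wr; apply/ler_addgt0Pr => e e0.
pose k := e / (b - a + 1).
have k0 : 0 < k by rewrite divr_gt0// ltr_wpDl ?subr_ge0.
have H : w b <= w a + k * (b - a).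
  apply: (@real_induction a b (fun t => w t <= w a + k * (t - a))) => //.
  - by rewrite subrr mulr0 addr0.
  - move=> t at_ tb tP; have := wr t at_ tb k k0.
    apply: filterS => u wu; have := tP t at_ (lexx _); lra.
  - move=> t at_ tb tP; apply/ler_addgt0Pr => e1 e10.
    have /near_leftP[d d0 dP] := wl t at_ tb e1 e10.
    pose s := Num.max a (t - d / 2).
    have st : s < t by rewrite /s gt_max at_/= ltrBlDr ltrDl divr_gt0.
    have as_ : a <= s by rewrite /s le_max lexx.
    have ds : t - d < s by rewrite /s lt_max; apply/orP; right; lra.
    have := dP s; rewrite st ds => /(_ isT).
    have := tP s as_ st.
    have : k * (s - a) <= k * (t - a) by rewrite ler_pM2l// lerD2r ltW.
    lra.
apply: (le_trans H); rewrite lerD2l /k mulrAC ler_pdivrMr ?ltr_wpDl ?subr_ge0//.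
by rewrite ler_pM2l// lerDl.
Qed.

(** Gronwall, by applying the previous lemma to exp (- k t) w t; nonnegativity
    of w turns the linear bound 1 + k h into exp (k h). *)
Lemma dini_gronwall (w : R -> R) (k a b : R) : a <= b ->
  (forall t, a <= t -> t <= b -> 0 <= w t) ->
  (forall t, a < t -> t <= b -> forall e, 0 < e ->
     \forall s \near t^'-, `|w s - w t| <= e) ->
  (forall t, a <= t -> t < b -> forall e, 0 < e ->
     \forall u \near t^'+, w u <= w t + (k * w t + e) * (u - t)) ->
  w b <= expR (k * (b - a)) * w a.
Proof.
move=> ab w0 wl wr.
suff H : expR (- k * (b - a)) * w b <= expR (- k * (a - a)) * w a.
  rewrite subrr mulr0 expR0 mul1r in H.
  rewrite -(ler_pM2l (expR_gt0 (- k * (b - a)))) mulrA -expRD mulNr addNr expR0.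
  by rewrite mul1r -mulNr.
apply: (@dini_nonincreasing (fun t => expR (- k * (t - a)) * w t)) => //.
- move=> t at_ tb e e0.
  have ex : expR (- k * (s - a)) * w s @[s --> t^'-] --> expR (- k * (t - a)) * w t.
    apply: cvgM.
      apply: cvg_at_left_filter.
      apply: (@continuous_comp _ _ _ (fun s => - k * (s - a)) expR); last first.
        exact: continuous_expR.
      by apply: cvgMr; apply: cvgB; [exact: cvg_id|exact: cvg_cst].
    apply/cvgrPdist_le => /= d d0; have := wl t at_ tb d d0.
    by apply: filterS => s; rewrite distrC.
  move/cvgrPdist_le : ex => /(_ e e0).
  by apply: filterS => s /=; rewrite ler_distlC => /andP[]; lra.
- move=> t at_ tb e e0.
  pose M := expR (`|k| * (b - a)).
  have M0 : 0 < M by exact: expR_gt0.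
  have := wr t at_ tb (e / M) (divr_gt0 e0 M0).
  move=> H; near=> u.
  have tu : t < u by near: u; exact: nbhs_right_gt.
  have ub : u <= b by near: u; exact: nbhs_right_le.
  have Hu : w u <= w t + (k * w t + e / M) * (u - t) by near: u.
  have E1 : expR (- k * (u - a)) * (1 + k * (u - t)) <= expR (- k * (t - a)).
    apply: (@le_trans _ _ (expR (- k * (u - a)) * expR (k * (u - t)))).
      by rewrite ler_pM2l ?expR_gt0// expR_ge1Dx.
    by rewrite -expRD le_eqVlt; apply/orP; left; apply/eqP; congr expR; ring.
  have E2 : expR (- k * (u - a)) <= M.
    rewrite ler_expR mulNr -mulrN; apply: (le_trans (ler_norm _)).
    rewrite normrM normrN ler_wpM2l// ger0_norm; lra.
  have wt := w0 t at_ (ltW tb).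
  have E0 := expR_ge0 (- k * (u - a)).
  have h1 : expR (- k * (u - a)) * w u <=
     expR (- k * (u - a)) * (1 + k * (u - t)) * w t +
     (expR (- k * (u - a)) / M) * (e * (u - t)).
    apply: (le_trans (ler_wpM2l E0 Hu)); lra.
  have h2 : expR (- k * (u - a)) * (1 + k * (u - t)) * w t <=
      expR (- k * (t - a)) * w t by exact: ler_wpM2r.
  have h3 : expR (- k * (u - a)) / M * (e * (u - t)) <= e * (u - t).
    rewrite -[leRHS]mul1r ler_wpM2r ?mulr_ge0 ?subr_ge0// ?(ltW e0) ?(ltW tu)//.
    by rewrite ler_pdivrMr// mul1r.
  by apply: (le_trans h1); exact: lerD.
Unshelve. all: by end_near. Qed.

End Dini.

(** * Trajectories *)

Section Trajectories.
Variable R : realType.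
Implicit Types (x y v w : R -> 'cV[R]_2) (t a b e : R).

(** Left continuity and a right derivative are exactly what the Dini lemmas
    need, and both are inherited by subintervals. *)
Definition traj a b x v : Prop :=
  (forall t, a < t -> t <= b -> forall e, 0 < e ->
     \forall s \near t^'-, enorm (x s - x t) <= e) /\
  (forall t, a <= t -> t < b -> forall e, 0 < e ->
     \forall u \near t^'+,
       enorm (x u - x t - (u - t) *: v t) <= e * (u - t)).

Lemma traj_sub a b a' b' x v : a <= a' -> b' <= b ->
  traj a b x v -> traj a' b' x v.
Proof.
move=> aa bb [xl xr]; split => t at_ tb.
- by apply: xl; [exact: le_lt_trans at_|exact: le_trans bb].
- by apply: xr; [exact: le_trans at_|exact: lt_le_trans bb].
Qed.

Lemma eq_traj a b x v w : (forall t, a <= t -> t < b -> v t = w t) ->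
  traj a b x v -> traj a b x w.
Proof.
move=> vw [xl xr]; split => // t at_ tb e e0.
by rewrite -vw//; exact: xr.
Qed.

Lemma traj_right_continuous a b x v t e : traj a b x v ->
  a <= t -> t < b -> 0 < e -> \forall u \near t^'+, enorm (x u - x t) <= e.
Proof.
move=> [_ xr] at_ tb e0; have xrt := xr t at_ tb 1 ltr01.
pose k := enorm (v t) + 1.
have k0 : 0 < k by rewrite ltr_wpDl ?enorm_ge0.
near=> u.
have tu : t < u by near: u; exact: nbhs_right_gt.
have ut : u <= t + e / k.
  by near: u; apply: nbhs_right_le; rewrite ltrDl divr_gt0.
have xu : enorm (x u - x t - (u - t) *: v t) <= 1 * (u - t) by near: u.
rewrite -[x u - x t](subrK ((u - t) *: v t)).
apply: (le_trans (enormD _ _)); rewrite enormZ gtr0_norm ?subr_gt0//.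
apply: (@le_trans _ _ ((u - t) * k)); first by rewrite /k; lra.
by rewrite -ler_pdivlMr// lerBlDl.
Unshelve. all: by end_near. Qed.

Lemma trajB a b x v y w : traj a b x v -> traj a b y w ->
  traj a b (fun t => x t - y t) (fun t => v t - w t).
Proof.
move=> [xl xr] [yl yr]; split=> t at_ tb e e0; have e2 : 0 < e / 2 by lra.
- move: (xl t at_ tb _ e2) (yl t at_ tb _ e2).
  apply: filterS2 => s hx hy.
  have -> : x s - y s - (x t - y t) = (x s - x t) - (y s - y t).
    by apply/matrixP => i j; rewrite !mxE; ring.
  by apply: (le_trans (enormD _ _)); rewrite enormN; lra.
- move: (xr t at_ tb _ e2) (yr t at_ tb _ e2).
  apply: filterS2 => s hx hy.
  have -> : x s - y s - (x t - y t) - (s - t) *: (v t - w t) =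
    (x s - x t - (s - t) *: v t) - (y s - y t - (s - t) *: w t).
    by apply/matrixP => i j; rewrite !mxE; ring.
  by apply: (le_trans (enormD _ _)); rewrite enormN; lra.
Qed.

Lemma traj_cst a b c : traj a b (fun=> c) (fun=> 0).
Proof.
split=> t _ _ e e0; near=> s; first by rewrite subrr enorm0 ltW.
rewrite subrr scaler0 subr0 enorm0 mulr_ge0 ?(ltW e0)// subr_ge0.
by near: s; exact: nbhs_right_ge.
Unshelve. all: by end_near. Qed.

(** The norm N is arbitrary because stability estimates will be measured in a
    norm adapted to a frozen matrix. *)
Lemma traj_norm_gronwall (N : 'cV[R]_2 -> R) (m k : R) a b x v :
  a <= b -> traj a b x v -> 0 < m ->
  (forall p, 0 <= N p) -> (forall p q, N (p + q) <= N p + N q) ->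
  (forall p, N p <= m * enorm p) ->
  (forall t, a <= t -> t < b -> forall e, 0 < e ->
     \forall u \near t^'+,
       N (x t + (u - t) *: v t) <= N (x t) + (k * N (x t) + e) * (u - t)) ->
  N (x b) <= expR (k * (b - a)) * N (x a).
Proof.
move=> ab [xl xr] m0 N0 ND Nm Nx.
have Nsub p q : N p <= N q + m * enorm (p - q).
  rewrite -{1}(subrK q p); apply: (le_trans (ND _ _)).
  by rewrite addrC lerD2l Nm.
apply: (@dini_gronwall _ (N \o x)) => //= t at_ tb e e0.
- have := xl t at_ tb (e / m) (divr_gt0 e0 m0).
  apply: filterS => s; rewrite ler_pdivlMr// mulrC => xs.
  have := Nsub (x s) (x t); have := Nsub (x t) (x s); rewrite enormB => h1 h2.
  by rewrite ler_distlC; apply/andP; split; lra.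
- have e2 : 0 < e / 2 by lra.
  have := Nx t at_ tb (e / 2) e2.
  have := xr t at_ tb (e / 2 / m) (divr_gt0 e2 m0).
  apply: filterS2 => u h1 h2.
  have := Nsub (x u) (x t + (u - t) *: v t).
  rewrite opprD addrA => h3.
  have h4 : m * (e / 2 / m * (u - t)) = e / 2 * (u - t).
    by field; rewrite gt_eqF.
  have := ler_wpM2l (ltW m0) h1; rewrite h4; lra.
Qed.

Lemma traj_gronwall (k : R) a b x v : a <= b -> traj a b x v ->
  (forall t, a <= t -> t < b -> enorm (v t) <= k * enorm (x t)) ->
  enorm (x b) <= expR (k * (b - a)) * enorm (x a).
Proof.
move=> ab xv vx; apply: (@traj_norm_gronwall _ 1 k a b x v) => //.
- exact: enorm_ge0.
- exact: enormD.
- by move=> y; rewrite mul1r.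
move=> t at_ tb e e0; near=> u.
have tu : t <= u by near: u; exact: nbhs_right_ge.
apply: (le_trans (enormD _ _)); rewrite lerD2l enormZ ger0_norm ?subr_ge0//.
by rewrite mulrC ler_wpM2r ?subr_ge0// (le_trans (vx _ _ _))// lerDl ltW.
Unshelve. all: by end_near. Qed.

(** The mean value inequality; B is any function that grows at least at rate
    C, so that |x t - x a| - B t does not increase. *)
Lemma traj_growth (B C : R -> R) a b x v : a <= b -> traj a b x v ->
  (forall t, a < t -> t <= b -> forall e, 0 < e ->
     \forall s \near t^'-, B s <= B t + e) ->
  (forall t u, a <= t -> t <= u -> B t + C t * (u - t) <= B u) ->
  (forall t, a <= t -> t < b -> enorm (v t) <= C t) ->
  enorm (x b - x a) <= B b - B a.
Proof.
move=> ab xv Bl BC vB.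
have [yl yr] := trajB xv (traj_cst a b (x a)).
suff : enorm (x b - x a) - B b <= enorm (x a - x a) - B a.
  by rewrite subrr enorm0; lra.
apply: (@dini_nonincreasing _ (fun t => enorm (x t - x a) - B t)) => //.
- move=> t at_ tb e e0; have e2 : 0 < e / 2 by lra.
  move: (yl t at_ tb _ e2) (Bl t at_ tb _ e2); apply: filterS2 => s xs Bs.
  have := enorm_sub (x t - x a) (x s - x a); rewrite enormB in xs.
  lra.
- move=> t at_ tb e e0; have yrt := yr t at_ tb e e0; near=> u.
  have tu : t < u by near: u; exact: nbhs_right_gt.
  have := BC t u at_ (ltW tu).
  have : enorm (x u - x a - (x t - x a) - (u - t) *: (v t - 0)) <= e * (u - t).
    by near: u.
  rewrite subr0.
  have := enorm_sub (x u - x a) (x t - x a).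
  have := enorm_sub (x u - x a - (x t - x a)) ((u - t) *: v t).
  rewrite enormZ gtr0_norm ?subr_gt0//.
  have : (u - t) * enorm (v t) <= (u - t) * C t.
    by rewrite ler_pM2l ?subr_gt0// vB.
  lra.
Unshelve. all: by end_near. Qed.

Lemma traj_lipschitz (d : R) a b x v : a <= b -> traj a b x v ->
  (forall t, a <= t -> t < b -> enorm (v t) <= d) ->
  enorm (x b - x a) <= d * (b - a).
Proof.
move=> ab xv vd; have d0 : a < b -> 0 <= d.
  by move=> ab'; exact: le_trans (enorm_ge0 _) (vd a _ _).
move: ab; rewrite le_eqVlt => /predU1P[<-|ab].
  by rewrite !subrr mulr0 enorm0.
rewrite mulrBr; apply: (@traj_growth (fun t => d * t) (fun=> d) a b x v) => //.
- exact: ltW.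
- move=> t _ _ e e0; near=> s.
  have /ltW : s < t by near: s; exact: nbhs_left_lt.
  by move=> /(ler_wpM2l (d0 ab)); lra.
- by move=> t u _ _; lra.
Unshelve. all: by end_near. Qed.

(** Gronwall for the difference of two solutions, which vanishes at a. *)
Lemma traj_unique (f : 'cV[R]_2 -> 'cV[R]_2) (L : R) a b x y : a <= b ->
  (forall z z', enorm (f z - f z') <= L * enorm (z - z')) ->
  traj a b x (f \o x) -> traj a b y (f \o y) -> x a = y a -> x b = y b.
Proof.
move=> ab fL xf yf xy; apply/eqP; rewrite -subr_eq0; apply/eqP/enorm_eq0.
apply/le_anti; rewrite enorm_ge0 andbT.
apply: (le_trans (@traj_gronwall L a b _ _ ab (trajB xf yf) _)).
  by move=> t _ _; exact: fL.
by rewrite xy subrr enorm0 mulr0.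
Qed.

Definition diff_at x t (l : 'cV[R]_2) : Prop :=
  forall e, 0 < e ->
    \forall u \near t, enorm (x u - x t - (u - t) *: l) <= e * `|u - t|.

Lemma diff_at_continuous x t l e : diff_at x t l -> 0 < e ->
  \forall u \near t, enorm (x u - x t) <= e.
Proof.
move=> xl e0; have xl1 := xl 1 ltr01.
pose k := enorm l + 1.
have k0 : 0 < k by rewrite ltr_wpDl ?enorm_ge0.
near=> u.
have ut : `|u - t| <= e / k.
  rewrite distrC; near: u; apply/nbhs_ballP.
  by exists (e / k) => [/=|u /ltW //]; exact: divr_gt0.
have xu : enorm (x u - x t - (u - t) *: l) <= 1 * `|u - t| by near: u.
rewrite -[x u - x t](subrK ((u - t) *: l)).
apply: (le_trans (enormD _ _)); rewrite enormZ.
apply: (@le_trans _ _ (`|u - t| * k)); first by rewrite /k; lra.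
by rewrite -ler_pdivlMr.
Unshelve. all: by end_near. Qed.

Lemma diff_at_traj a b x v :
  (forall t, a <= t -> t <= b -> diff_at x t (v t)) -> traj a b x v.
Proof.
move=> xv; split=> t at_ tb e e0.
- have := diff_at_continuous (xv t (ltW at_) tb) e0.
  exact: cvg_within.
- have xe := xv t at_ (ltW tb) e e0.
  near=> u; have tu : t < u by near: u; exact: nbhs_right_gt.
  rewrite -[X in _ * X]gtr0_norm ?subr_gt0//; near: u.
  exact: cvg_within.
Unshelve. all: by end_near. Qed.

Lemma is_derive_expansion (F : R -> R) t (l e : R) : is_derive t 1 F l -> 0 < e ->
  \forall u \near t, `|F u - F t - (u - t) * l| <= e * `|u - t|.
Proof.
move=> [dF <-] e0; have /cvgrPdist_le/(_ e e0) := dF.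
case=> d /= d0 dP; exists d => //= u tu.
have [->|ut] := eqVneq u t; first by rewrite !subrr mul0r subrr normr0 mulr0.
have ut0 : u - t != 0 by rewrite subr_eq0.
have := dP (u - t); rewrite /= sub0r normrN distrC => /(_ tu ut0).
rewrite [_%:A]mulr1 subrK => h.
have -> : F u - F t - (u - t) * 'D_1 F t =
  - (u - t) * ('D_1 F t - (u - t)^-1 *: (F u - F t)).
  by rewrite /GRing.scale/=; field.
by rewrite normrM normrN mulrC [`|t - u|]distrC ler_wpM2r.
Qed.

Lemma coord_diff_at x t (l : 'cV[R]_2) :
  (forall i, is_derive t 1 (fun s => x s i 0 : R) (l i 0)) -> diff_at x t l.
Proof.
move=> xl e e0; have e2 : 0 < e / 2 by lra.
have := is_derive_expansion (xl 0) e2; have := is_derive_expansion (xl 1) e2.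
apply: filterS2 => u h1 h0; apply: (le_trans (enorm_le_coord _)).
by rewrite !mxE; lra.
Qed.

Lemma diff_at_solution (f : 'cV[R]_2 -> 'cV[R]_2) x :
  (forall t, 0 <= t -> diff_at x t (f (x t))) -> solution f +oo%E x.
Proof.
move=> xf t t0 _; apply/cvgrPdist_le => /= e e0.
have [d /= d0 dP] := xf t t0 e e0.
exists d => //= u tu ut _; have := dP u tu.
have ut0 : u - t != 0 by rewrite subr_eq0.
have ut1 : 0 < `|u - t| by rewrite normr_gt0.
rewrite -[leLHS]mulr1 => h; apply: (le_trans (norm_le_enorm _)).
have -> : f (x t) - (u - t)^-1 *: (x u - x t) =
  - (u - t)^-1 *: (x u - x t - (u - t) *: f (x t)).
  by apply/matrixP => i j; rewrite !mxE; field.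
by rewrite enormZ normrN normfV mulrC ler_pdivrMr// -[leLHS]mulr1.
Qed.

Lemma solution_traj (f : 'cV[R]_2 -> 'cV[R]_2) (T : \bar R) x b :
  solution f T x -> (b%:E < T)%E -> traj 0 b x (f \o x).
Proof.
move=> xf bT.
have H t : 0 <= t -> t <= b -> forall e, 0 < e -> exists2 d, 0 < d &
    forall u, `|t - u| < d -> 0 <= u -> (u%:E < T)%E ->
      enorm (x u - x t - (u - t) *: f (x t)) <= e * `|u - t|.
  move=> t0 tb e e0.
  have tT : (t%:E < T)%E by apply: le_lt_trans bT; rewrite lee_fin.
  have e2 : 0 < e / 2 by lra.
  have /cvgrPdist_le/(_ _ e2)[d /= d0 dP] := xf t t0 tT.
  exists d => // u tu u0 uT.
  have [->|ut] := eqVneq u t.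
    by rewrite !subrr scale0r subrr enorm0 normr0 mulr0.
  have ut0 : u - t != 0 by rewrite subr_eq0.
  have := dP u tu ut (conj u0 uT) => h.
  have -> : x u - x t - (u - t) *: f (x t) =
    - (u - t) *: (f (x t) - (u - t)^-1 *: (x u - x t)).
    by apply/matrixP => i j; rewrite !mxE; field.
  rewrite enormZ normrN mulrC ler_wpM2r//.
  by apply: (le_trans (enorm_le_norm _)); lra.
split=> t t0 tb e e0.
- have [d d0 dP] := H t (ltW t0) tb 1 ltr01.
  pose k := enorm (f (x t)) + 1.
  have k0 : 0 < k by rewrite ltr_wpDl ?enorm_ge0.
  near=> s.
  have st : s < t by near: s; exact: nbhs_left_lt.
  have s0 : 0 <= s by near: s; exact: nbhs_left_ge.
  have sd : t - d < s by near: s; apply: nbhs_left_gt; rewrite ltrBlDr ltrDl.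
  have se : t - e / k <= s.
    by near: s; apply: nbhs_left_ge; rewrite ltrBlDr ltrDl divr_gt0.
  have := dP s; rewrite gtr0_norm ?subr_gt0// ltrBlDl -ltrBlDr => /(_ sd s0).
  rewrite mul1r ltr0_norm ?subr_lt0// opprB.
  have -> : (s%:E < T)%E.
    by apply: le_lt_trans bT; rewrite lee_fin (le_trans (ltW st)).
  move=> /(_ isT) h.
  rewrite -[x s - x t](subrK ((s - t) *: f (x t))).
  apply: (le_trans (enormD _ _)); rewrite enormZ distrC gtr0_norm ?subr_gt0//.
  apply: (@le_trans _ _ ((t - s) * k)); first by rewrite /k; lra.
  by rewrite -ler_pdivlMr// lerBlDr -lerBlDl.
- have [d d0 dP] := H t t0 (ltW tb) e e0.
  apply/near_rightP; exists (Num.min d (b - t)).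
    by rewrite lt_min d0 subr_gt0.
  move=> u /andP[tu]; rewrite -ltrBlDl lt_min => /andP[ud ub].
  have := dP u; rewrite ltr0_norm ?subr_lt0// opprB => /(_ ud).
  rewrite gtr0_norm ?subr_gt0//; apply; first exact: le_trans (ltW tu).
  by apply: lt_trans bT; rewrite lte_fin; lra.
Unshelve. all: by end_near. Qed.

End Trajectories.

(** * The matrix exponential *)

Section MatrixExponential.
Variable R : realType.
Implicit Types (A : 'M[R]_2) (v : 'cV[R]_2).

(** A class of power series with infinite radius of convergence that contains
    the entries of the exponential series and is closed under termwise
    differentiation. *)
Definition exp_bounded (c : R^nat) : Prop :=
  exists C r, [/\ 0 <= C, 0 <= r & forall k, `|c k| <= C * (r ^+ k / k`!%:R)].

Lemma is_cvg_pseries_exp_bounded (c : R^nat) x :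
  exp_bounded c -> cvgn (pseries c x).
Proof.
move=> [C [r [C0 r0 cC]]]; apply: normed_cvg.
apply: (@series_le_cvg _ _ (fun k => C * exp_coeff (r * `|x|) k)) => [k|k|k|].
- exact: normr_ge0.
- by rewrite /exp_coeff/= mulr_ge0// divr_ge0// exprn_ge0// mulr_ge0.
- rewrite /exp_coeff/= normrM normrX exprMn.
  apply: (le_trans (ler_wpM2r _ (cC k))); first exact: exprn_ge0.
  by rewrite le_eqVlt; apply/orP; left; apply/eqP; ring.
- exact: (@is_cvg_seriesZ _ _ C (is_cvg_series_exp_coeff (r * `|x|))).
Qed.

Lemma exp_bounded_diffs (c : R^nat) : exp_bounded c -> exp_bounded (pseries_diffs c).
Proof.
move=> [C [r [C0 r0 cC]]]; exists (C * r), r; split=> //; first exact: mulr_ge0.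
move=> k; rewrite /pseries_diffs normrM ger0_norm//.
apply: (le_trans (ler_wpM2l _ (cC _))) => //.
rewrite factS natrM exprS le_eqVlt; apply/orP; left; apply/eqP.
by field; rewrite nat1r !pnatr_eq0 -lt0n fact_gt0.
Qed.

Lemma is_derive_pseries_exp_bounded (c : R^nat) (x : R) : exp_bounded c ->
  is_derive x 1 (fun y : R => limn (pseries c y) : R)
    (limn (pseries (pseries_diffs c) x)).
Proof.
move=> cb; have db := exp_bounded_diffs cb.
apply: (@pseries_snd_diffs _ c (`|x| + 1)).
- exact: is_cvg_pseries_exp_bounded.
- exact: is_cvg_pseries_exp_bounded.
- exact/is_cvg_pseries_exp_bounded/exp_bounded_diffs.
- by rewrite (ger0_norm (addr_ge0 _ _))// ltrDl.
Qed.

Definition mexp_coef A (i j : 'I_2) : R^nat := fun k => (A ^+ k) i j / k`!%:R.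

Lemma mexp_coef_bounded A i j : exp_bounded (mexp_coef A i j).
Proof.
pose r := `|A 0 0| + `|A 0 1| + (`|A 1 0| + `|A 1 1|).
have r0 : 0 <= r by rewrite !addr_ge0.
exists 1, r; split=> // k.
rewrite mul1r /mexp_coef normrM [`|_^-1|]ger0_norm ?invr_ge0//.
rewrite ler_wpM2r ?invr_ge0//.
elim: k i => [|k IH] i.
  by rewrite !expr0 mxE; case: eqP => _; rewrite ?normr1 ?normr0.
rewrite exprS mxE sum2 exprS; apply: (le_trans (ler_normD _ _)).
rewrite !normrM; apply: (@le_trans _ _ ((`|A i 0| + `|A i 1|) * r ^+ k)).
  by rewrite mulrDl lerD// ler_wpM2l.
rewrite ler_wpM2r ?exprn_ge0// /r.
by case: (ord2P i) => ->; rewrite ?lerDl ?lerDr addr_ge0.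
Qed.

Lemma cvg_mx2 (T : Type) (F : set_system T) (FF : Filter F)
    (u : T -> 'M[R]_2) (l : 'M[R]_2) :
  (forall i j, u n i j @[n --> F] --> l i j) -> u n @[n --> F] --> l.
Proof.
move=> ul; apply/cvgrPdist_le => /= e e0.
have H i j : \forall n \near F, `|l i j - u n i j| <= e.
  by move/cvgrPdist_le : (ul i j); apply.
near=> n; rewrite /Num.norm/= mx_normrE; apply: bigmax_le => [|[i j] _ /=].
  exact: ltW.
rewrite !mxE; case: (ord2P i) (ord2P j) => -> [->|->]; near: n; exact: H.
Unshelve. all: by end_near. Qed.

Lemma mexpE A (t : R) i j : mexp (t *: A) i j = limn (pseries (mexp_coef A i j) t).
Proof.
pose l := \matrix_(i, j) limn (pseries (mexp_coef A i j) t).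
suff -> : mexp (t *: A) = l by rewrite mxE.
apply: cvg_lim; first exact: norm_hausdorff.
apply: cvg_mx2 => {}i {}j; rewrite /l mxE.
have -> : (fun n => (\sum_(k < n) (k`!%:R)^-1 *: (t *: A) ^+ k) i j) =
  pseries (mexp_coef A i j) t.
  apply/funext => n; rewrite /pseries/= /series/= big_mkord summxE.
  by apply: eq_bigr => k _; rewrite exprZn !mxE /mexp_coef; ring.
exact/is_cvg_pseries_exp_bounded/mexp_coef_bounded.
Qed.

(** Termwise differentiation turns A^k / k! into A (A^k / k!). *)
Lemma pseries_diffs_mexp_coef A i j (t : R) :
  limn (pseries (pseries_diffs (mexp_coef A i j)) t) =
  A i 0 * mexp (t *: A) 0 j + A i 1 * mexp (t *: A) 1 j.
Proof.
have -> : pseries (pseries_diffs (mexp_coef A i j)) t =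
  (fun n => A i 0 * pseries (mexp_coef A 0 j) t n +
            A i 1 * pseries (mexp_coef A 1 j) t n).
  apply/funext => n; rewrite /pseries/= /series/= !mulr_sumr -big_split/=.
  apply: eq_bigr => k _; rewrite /pseries_diffs /mexp_coef exprS mxE sum2.
  by rewrite factS natrM; field; rewrite nat1r !pnatr_eq0 -lt0n fact_gt0.
have cv l : pseries (mexp_coef A l j) t @ \oo --> mexp (t *: A) l j.
  by rewrite mexpE; exact/is_cvg_pseries_exp_bounded/mexp_coef_bounded.
apply: cvg_lim; first exact: Rhausdorff.
by apply: cvgD; apply: cvgMl_tmp; exact: cv.
Qed.

Lemma mexp_is_derive A v (t : R) i :
  is_derive t 1 (fun s : R => (mexp (s *: A) *m v) i 0 : R)
    ((A *m (mexp (t *: A) *m v)) i 0).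
Proof.
have D j : is_derive t 1 (fun s : R => mexp (s *: A) i j : R)
    (A i 0 * mexp (t *: A) 0 j + A i 1 * mexp (t *: A) 1 j).
  rewrite -pseries_diffs_mexp_coef.
  under eq_fun do rewrite mexpE.
  exact/is_derive_pseries_exp_bounded/mexp_coef_bounded.
have -> : (fun s : R => (mexp (s *: A) *m v) i 0) =
  (fun s => v 0 0 *: (mexp (s *: A) i 0 : R) + v 1 0 *: (mexp (s *: A) i 1 : R)).
  apply/funext => s; rewrite mulmx2E /GRing.scale/=; ring.
apply: is_derive_eq.
rewrite !mulmx2E /GRing.scale/=; ring.
Qed.

Lemma mexp_diff_at A v t :
  diff_at (fun s => mexp (s *: A) *m v) t (A *m (mexp (t *: A) *m v)).
Proof. by apply: coord_diff_at => i; exact: mexp_is_derive. Qed.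

Lemma mexp_solution A v :
  solution (fun y => A *m y) +oo%E (fun t => mexp (t *: A) *m v).
Proof. by apply: diff_at_solution => t _; exact: mexp_diff_at. Qed.

Lemma mexp0 v : mexp (0 : 'M[R]_2) *m v = v.
Proof.
suff -> : mexp (0 : 'M[R]_2) = 1%:M by rewrite mul1mx.
apply: lim_near_cst; first exact: norm_hausdorff.
near=> n; have n0 : (0 < n)%N by near: n; exact: nbhs_infty_gt.
rewrite -(prednK n0) big_ord_recl/= big1 ?addr0 => [|k _].
  by rewrite expr0 fact0 invr1 scale1r.
by rewrite exprS mul0r scaler0.
Unshelve. all: by end_near. Qed.

Lemma trmx_exp A k : (A ^+ k)^T = A^T ^+ k.
Proof.
elim: k => [|k IH]; first by rewrite !expr0 trmx1.
by rewrite exprS exprSr -IH; exact: trmx_mul.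
Qed.

Lemma mexp_trmx A (t : R) : mexp (t *: A^T) = (mexp (t *: A))^T.
Proof.
apply/matrixP => i j; rewrite mxE !mexpE; congr (limn (pseries _ _)).
by apply/funext => k; rewrite /mexp_coef -trmx_exp mxE.
Qed.

(** The semigroup law, as uniqueness for the linear equation. *)
Lemma mexpD A v (s t : R) : 0 <= s ->
  mexp ((s + t) *: A) *m v = mexp (s *: A) *m (mexp (t *: A) *m v).
Proof.
move=> s0.
apply: (@traj_unique _ (fun y => A *m y) (opnorm A) 0 s
  (fun s => mexp ((s + t) *: A) *m v)
  (fun s => mexp (s *: A) *m (mexp (t *: A) *m v))) => //.
- by move=> z z'; rewrite -mulmxBr enorm_mulmx.
- apply: diff_at_traj => r _ _ e e0.
  have shift : u + t @[u --> r] --> r + t.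
    by apply: cvgD; [exact: cvg_id|exact: cvg_cst].
  apply: (@filterS _ _ (nbhs_filter r) _ _ _
    (shift _ (mexp_diff_at A v (r + t) e0))) => u.
  by rewrite /= opprD addrACA subrr addr0.
- by apply: diff_at_traj => r _ _; exact: mexp_diff_at.
- by rewrite add0r scale0r mexp0.
Qed.

End MatrixExponential.

(** * Perturbation of exponentially stable linear equations *)

Section Perturbation.
Variable R : realType.
Implicit Types (A : 'M[R]_2) (v y : 'cV[R]_2).

Definition decays A (m l : R) : Prop := forall v t, 0 <= t ->
  enorm (mexp (t *: A) *m v) <= m * expR (- l * t) * enorm v.

Section AdaptedNorm.
Variables (A : 'M[R]_2) (m l : R).
Hypothesis Aml : decays A m l.

(** In this norm the flow of A contracts at rate l without the constant m. *)
Definition adapted_norm v : R :=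
  sup [set expR (l * t) * enorm (mexp (t *: A) *m v) | t in [set t | 0 <= t]].

Local Notation N := adapted_norm.

Lemma adapted_norm_ubound v : ubound
  [set expR (l * t) * enorm (mexp (t *: A) *m v) | t in [set t | 0 <= t]]
  (m * enorm v).
Proof.
move=> _ [t /= t0 <-].
apply: (@le_trans _ _ (expR (l * t) * (m * expR (- l * t) * enorm v))).
  by rewrite ler_wpM2l ?expR_ge0// Aml.
have : expR (l * t) * expR (- l * t) = 1 by rewrite -expRD mulNr subrr expR0.
move=> E; rewrite le_eqVlt; apply/orP; left; apply/eqP.
by rewrite mulrA mulrCA E mulr1.
Qed.

Lemma le_adapted_norm v t : 0 <= t ->
  expR (l * t) * enorm (mexp (t *: A) *m v) <= N v.
Proof.
move=> t0; apply: sup_ubound; last by exists t.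
by exists (m * enorm v); exact: adapted_norm_ubound.
Qed.

Lemma adapted_norm_le v C :
  (forall t, 0 <= t -> expR (l * t) * enorm (mexp (t *: A) *m v) <= C) -> N v <= C.
Proof.
move=> vC; apply: sup_le_ub; last by move=> _ [t /= t0 <-]; exact: vC.
by exists (expR (l * 0) * enorm (mexp (0 *: A) *m v)); exists 0 => /=.
Qed.

Lemma enorm_le_adapted_norm v : enorm v <= N v.
Proof.
have := @le_adapted_norm v 0 (lexx _).
by rewrite mulr0 expR0 mul1r scale0r mexp0.
Qed.

Lemma adapted_norm_le_enorm v : N v <= m * enorm v.
Proof. by apply: adapted_norm_le => t t0; apply: adapted_norm_ubound; exists t. Qed.

Lemma adapted_normD v y : N (v + y) <= N v + N y.
Proof.
apply: adapted_norm_le => t t0; rewrite mulmxDr.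
apply: (le_trans _ (lerD (le_adapted_norm v t0) (le_adapted_norm y t0))).
by rewrite -mulrDr ler_wpM2l ?expR_ge0// enormD.
Qed.

Lemma adapted_norm_flow v h : 0 <= h ->
  N (mexp (h *: A) *m v) <= expR (- l * h) * N v.
Proof.
move=> h0; apply: adapted_norm_le => t t0; rewrite -mexpD//.
have -> : expR (l * t) = expR (- l * h) * expR (l * (t + h)).
  by rewrite -expRD; congr expR; ring.
rewrite -mulrA ler_wpM2l ?expR_ge0//.
by apply: le_adapted_norm; exact: addr_ge0.
Qed.

End AdaptedNorm.

Lemma near_right_shift (P : R -> Prop) (t : R) :
  (\forall h \near (0 : R), P h) -> \forall u \near t^'+, P (u - t).
Proof.
move=> P0; apply: cvg_within.
have shift : u - t @[u --> t] --> (0 : R).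
  by rewrite -(subrr t); apply: cvgB; [exact: cvg_id|exact: cvg_cst].
exact: (@filterS _ _ (nbhs_filter t) _ _ _ (shift _ P0)).
Qed.

(** The adapted norm N of A satisfies N (x + h x') <=
    N (exp (h A) x) + h m eps |x| + o(h) <= (1 + (m eps - l) h) N x + o(h). *)
Lemma perturbed_decay A (m l eps : R) (a b : R) (x v : R -> 'cV[R]_2) :
  1 <= m -> 0 <= eps -> decays A m l -> a <= b -> traj a b x v ->
  (forall t, a <= t -> t < b -> enorm (v t - A *m x t) <= eps * enorm (x t)) ->
  enorm (x b) <= m * expR ((m * eps - l) * (b - a)) * enorm (x a).
Proof.
move=> m1 eps0 Aml ab xv vA.
pose N := adapted_norm A l.
have m0 : 0 < m by exact: lt_le_trans m1.
have Nm := adapted_norm_le_enorm Aml.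
have N0 y : 0 <= N y.
  exact: le_trans (enorm_ge0 _) (enorm_le_adapted_norm Aml y).
apply: (le_trans (enorm_le_adapted_norm Aml _)).
rewrite -mulrA mulrCA.
apply: (@le_trans _ _ (expR ((m * eps - l) * (b - a)) * N (x a))); last first.
  by rewrite ler_wpM2l ?expR_ge0// Nm.
apply: (@traj_norm_gronwall _ N m (m * eps - l) a b x v) => //.
  exact: (adapted_normD Aml).
move=> t at_ tb e e0.
pose e1 := e / 2 / (N (x t) + 1).
have Np : 0 < N (x t) + 1 by rewrite ltr_wpDl.
have e10 : 0 < e1 by rewrite !divr_gt0.
pose e2 := e / 2 / m.
have e20 : 0 < e2 by rewrite !divr_gt0.
have Dexp : is_derive (0 : R) 1 (fun s : R => expR (- l * s) : R) (- l).
  apply: is_derive_eq; rewrite mulr0 expR0 /GRing.scale/= mulr1.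
  by rewrite ?mulr1 ?mul1r.
have exph := near_right_shift t (is_derive_expansion Dexp e10).
have mexph := near_right_shift t (mexp_diff_at A (x t) 0 e20).
near=> u.
have tu : t < u by near: u; exact: nbhs_right_gt.
have h0 : 0 < u - t by rewrite subr_gt0.
have E1 : `|expR (- l * (u - t)) - expR (- l * 0) - (u - t - 0) * - l| <=
    e1 * `|u - t - 0|.
  by near: u.
have E2 : enorm (mexp ((u - t) *: A) *m x t - mexp (0 *: A) *m x t -
    (u - t - 0) *: (A *m (mexp (0 *: A) *m x t))) <= e2 * `|u - t - 0|.
  by near: u.
set h := u - t in h0 E1 E2 *.
rewrite mulr0 expR0 !subr0 (gtr0_norm h0) in E1.
rewrite scale0r mexp0 !subr0 (gtr0_norm h0) in E2.
have -> : x t + h *: v t = mexp (h *: A) *m x t +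
  (h *: (v t - A *m x t) - (mexp (h *: A) *m x t - x t - h *: (A *m x t))).
  move: (mexp _ *m _) (A *m _) => p q.
  by apply/matrixP => i j; rewrite !mxE; ring.
apply: (le_trans (adapted_normD Aml _ _)).
apply: (le_trans (lerD (adapted_norm_flow Aml _ (ltW h0)) (Nm _))).
have E3 : expR (- l * h) <= 1 - l * h + e1 * h.
  by have := ler_norm (expR (- l * h) - 1 - h * - l); lra.
have E4 := ler_wpM2r (N0 (x t)) E3.
have E5 : e1 * N (x t) <= e / 2.
  by rewrite /e1 mulrAC ler_pdivrMr// ler_pM2l ?divr_gt0// lerDl.
have E6 := ler_wpM2r (ltW h0) E5.
have E7 : enorm (h *: (v t - A *m x t) -
    (mexp (h *: A) *m x t - x t - h *: (A *m x t))) <=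
    h * (eps * N (x t)) + e2 * h.
  apply: (le_trans (enormD _ _)); rewrite enormN lerD// enormZ gtr0_norm//.
  rewrite ler_pM2l//; apply: (le_trans (vA t at_ tb)).
  by rewrite ler_wpM2l// (enorm_le_adapted_norm Aml).
have E8 := ler_wpM2l (ltW m0) E7.
have E9 : m * (e2 * h) = e / 2 * h by rewrite /e2; field; rewrite gt_eqF.
rewrite mulrDr E9 in E8.
rewrite -/N; lra.
Unshelve. all: by end_near. Qed.

(** Freezing the matrix at the midpoint of an interval of length d <= h costs
    at most eps = l / (2 m), which leaves the rate l / 2; a step of full length
    h then absorbs the factor m. *)
Lemma slowly_varying_decay (A : R -> 'M[R]_2) (m l h b : R) (x : R -> 'cV[R]_2) :
  1 <= m -> 0 < l -> 0 < h -> m <= expR (l * h / 4) ->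
  (forall t, 0 <= t -> t < b -> decays (A t) m l) ->
  (forall s t, 0 <= s -> s < b -> 0 <= t -> t < b ->
     opnorm (A s - A t) <= l / (m * h) * `|s - t|) ->
  0 <= b -> traj 0 b x (fun t => A t *m x t) ->
  enorm (x b) <= m * expR (- (l / 4) * b) * enorm (x 0).
Proof.
move=> m1 l0 h0 mh Adec Alip b0 xA.
have m0 : 0 < m by exact: lt_le_trans m1.
have step s d : 0 <= s -> 0 <= d -> d <= h -> s + d <= b ->
    enorm (x (s + d)) <= m * expR (- (l / 2) * d) * enorm (x s).
  move=> s0; rewrite le_eqVlt => /predU1P[<- _ _|d0 dh sdb].
    by rewrite addr0 mulr0 expR0 mulr1 ler_peMl ?enorm_ge0.
  pose c := s + d / 2.
  have c0 : 0 <= c by rewrite /c; lra.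
  have cb : c < b by rewrite /c; lra.
  have := @perturbed_decay (A c) m l (l / (2 * m)) s (s + d) x
    (fun t => A t *m x t) m1.
  have -> : (m * (l / (2 * m)) - l) * (s + d - s) = - (l / 2) * d.
    by field; rewrite gt_eqF.
  apply.
  - by rewrite divr_ge0 ?mulr_ge0 ?ltW.
  - exact: Adec.
  - by rewrite lerDl ltW.
  - by apply: traj_sub xA.
  move=> t st td; rewrite -mulmxBl.
  apply: (le_trans (enorm_mulmx _ _)); rewrite ler_wpM2r ?enorm_ge0//.
  have t0 : 0 <= t by exact: le_trans st.
  apply: (le_trans (Alip _ _ t0 (lt_le_trans td sdb) c0 cb)).
  apply: (@le_trans _ _ (l / (m * h) * (h / 2))); last first.
    by rewrite le_eqVlt; apply/orP; left; apply/eqP; field; rewrite !gt_eqF.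
  rewrite ler_wpM2l ?divr_ge0 ?mulr_ge0 ?(ltW l0) ?(ltW m0) ?(ltW h0)//.
  by rewrite ler_norml /c; apply/andP; split; lra.
have steps n : n%:R * h <= b ->
    enorm (x (n%:R * h)) <= expR (- (l * h / 4) * n%:R) * enorm (x 0).
  elim: n => [_|n IH nb]; first by rewrite mul0r mulr0 expR0 mul1r.
  have nE : n.+1%:R * h = n%:R * h + h by rewrite -natr1 mulrDl mul1r.
  have nb' : n%:R * h <= b by apply: le_trans nb; rewrite nE lerDl ltW.
  rewrite nE; apply: (le_trans (step _ _ _ (ltW h0) (lexx h) _)).
  - by rewrite mulr_ge0// ltW.
  - by rewrite -nE.
  apply: (@le_trans _ _ (expR (- (l * h / 4)) *
      (expR (- (l * h / 4) * n%:R) * enorm (x 0)))); last first.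
    rewrite mulrA -expRD -natr1 le_eqVlt; apply/orP; left; apply/eqP.
    by congr (expR _ * _); ring.
  apply: ler_pM; [by rewrite mulr_ge0 ?expR_ge0 ?ltW|exact: enorm_ge0| |exact: IH].
  have -> : - (l * h / 4) = l * h / 4 + - (l / 2) * h by field.
  by rewrite expRD ler_wpM2r ?expR_ge0.
pose n := Num.truncn (b / h).
have bh0 : 0 <= b / h by rewrite divr_ge0// ltW.
have /andP[nb bn] := truncn_itv bh0; rewrite -/n in nb bn.
have nhb : n%:R * h <= b by rewrite -ler_pdivlMr.
have bnh : b < n%:R * h + h.
  by rewrite -[X in _ + X]mul1r -mulrDl natr1 -ltr_pdivrMr.
pose d := b - n%:R * h.
have bE : b = n%:R * h + d by rewrite /d; ring.
have d0 : 0 <= d by rewrite /d; lra.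
rewrite {1}bE; apply: (le_trans (step _ _ _ d0 _ _)).
- by rewrite mulr_ge0// ltW.
- by rewrite /d; lra.
- by rewrite -bE.
apply: (le_trans (ler_wpM2l _ (steps n nhb))).
  by rewrite mulr_ge0 ?expR_ge0// ltW.
rewrite mulrA ler_wpM2r ?enorm_ge0// -[leLHS]mulrA ler_pM2l// -expRD ler_expR bE.
have : 0 <= l * d by rewrite mulr_ge0// ltW.
lra.
Qed.

End Perturbation.

(** * Global solutions of Lipschitz equations *)

Section Existence.
Variable R : realType.
Implicit Types (z : 'cV[R]_2) (X : R -> 'cV[R]_2).

(** The intervals of radius 2 M / 2^n around u n are nested, and the limit is
    their common point. *)
Lemma geometric_cauchy_limit (u : R^nat) (M : R) :
  (forall n, `|u n.+1 - u n| <= M * 2^-1 ^+ n) ->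
  exists l, forall n, `|l - u n| <= 2 * M * 2^-1 ^+ n.
Proof.
move=> uM.
have step n : u n - 2 * M * 2^-1 ^+ n <= u n.+1 - 2 * M * 2^-1 ^+ n.+1 /\
              u n.+1 + 2 * M * 2^-1 ^+ n.+1 <= u n + 2 * M * 2^-1 ^+ n.
  move: (uM n); rewrite exprS ler_norml => /andP[].
  by set q := _ ^+ n; split; lra.
pose a n := u n - 2 * M * 2^-1 ^+ n.
pose b n := u n + 2 * M * 2^-1 ^+ n.
have aM : {homo a : n m / (n <= m)%N >-> n <= m}.
  by apply: homo_leq => // [x y z|n]; [exact: le_trans|exact: (step n).1].
have bM : {homo b : n m / (n <= m)%N >-> m <= n}.
  apply: (@homo_leq _ b (fun x y => y <= x)) => // [y x z xy yz|n].
    exact: le_trans yz xy.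
  exact: (step n).2.
have M0 : 0 <= M by have := uM 0%N; rewrite expr0 mulr1; exact: le_trans.
have ab n : a n <= b n.
  have : 0 <= 2 * M * 2^-1 ^+ n by rewrite mulr_ge0 ?exprn_ge0 ?invr_ge0 ?mulr_ge0.
  by rewrite /a /b; lra.
have abnm n m : a n <= b m.
  apply: (le_trans (aM _ _ (leq_maxl n m))); apply: (le_trans (ab _)).
  by apply: bM; exact: leq_maxr.
exists (sup (range a)) => n.
have la : a n <= sup (range a).
  apply: sup_ubound; last by exists n.
  by exists (b 0%N) => _ [m _ <-].
have lb : sup (range a) <= b n.
  by apply: sup_le_ub; [exists (a 0%N); exists 0%N|move=> _ [m _ <-]].
by rewrite ler_distl; move: la lb; rewrite /b {1}/a => -> ->.
Qed.

Lemma le0_of_geometric (x M : R) : (forall n, x <= M * 2^-1 ^+ n) -> x <= 0.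
Proof.
move=> xM.
have cv : M * 2^-1 ^+ n @[n --> \oo] --> M * 0.
  apply: cvgMl_tmp; apply: cvg_expr.
  by rewrite ger0_norm ?invr_ge0// invf_lt1// ltr1n.
rewrite mulr0 in cv; rewrite -(cvg_lim (@Rhausdorff R) cv).
by apply: limr_ge; [exact: cvgP cv|exact: nearW].
Qed.

(** The lower limit -1 makes 0 an interior point, so that the derivative at 0
    is two-sided. *)
Definition primitive (g : R -> R) (t : R) : R :=
  (\int[lebesgue_measure]_(s in `[-1, t]) g s) -
  \int[lebesgue_measure]_(s in `[-1, 0]) g s.

Lemma primitive0 g : primitive g 0 = 0.
Proof. exact: subrr. Qed.

Lemma is_derive_primitive (g : R -> R) (t : R) : continuous g -> 0 <= t ->
  is_derive t 1 (primitive g) (g t).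
Proof.
move=> cg t0.
have [] := @continuous_FTC1_closed R g (-1) t (t + 1).
- by rewrite ltrDl.
- by apply: continuous_compact_integrable; [exact: segment_compact|
    exact: continuous_subspaceT].
- by lra.
- exact: cg.
move=> dG GE.
have DG : is_derive t 1
    (fun t => \int[lebesgue_measure]_(s in `[-1, t]) g s : R) (g t).
  by apply: DeriveDef => //; rewrite -derive1E.
by rewrite /primitive; apply: is_derive_eq; rewrite subr0.
Qed.

Definition econtinuous X : Prop :=
  forall t e, 0 < e -> \forall u \near t, enorm (X u - X t) <= e.

Lemma econtinuous_coord X i : econtinuous X -> continuous (fun t => X t i 0 : R).
Proof.
move=> cX t; apply/cvgrPdist_le => /= e e0; apply: filterS (cX t e e0) => u.
rewrite enormB; apply: le_trans.
by have := coord_le_enorm (X t - X u) i; rewrite !mxE.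
Qed.

Definition clamp (t : R) : R := Num.max t 0.

Lemma clamp_ge0 t : 0 <= clamp t. Proof. by rewrite le_max lexx orbT. Qed.

Lemma clampK t : 0 <= t -> clamp t = t. Proof. exact: max_l. Qed.

Lemma clamp_dist t u : `|clamp t - clamp u| <= `|t - u|.
Proof.
rewrite /clamp /Order.max ler_norml.
have := ler_norm (t - u); have := ler_norm (u - t); rewrite [`|u - t|]distrC.
by case: (ltP t 0) => ?; case: (ltP u 0) => ? ? ?; apply/andP; split; lra.
Qed.

Lemma near_clamp (P : R -> Prop) t :
  (\forall u \near clamp t, P u) -> \forall u \near t, P (clamp u).
Proof.
move=> [d /= d0 dP]; exists d => //= u tu; apply: dP => /=.
exact: le_lt_trans (clamp_dist _ _) tu.
Qed.

Section Picard.
Variables (f : 'cV[R]_2 -> 'cV[R]_2) (L : R) (x0 : 'cV[R]_2).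
Hypothesis L0 : 0 < L.
Hypothesis fL : forall z z', enorm (f z - f z') <= L * enorm (z - z').

(** Only times t >= 0 matter; extending the integrand by its value at 0 keeps
    it continuous on the whole line. *)
Definition picard_step X (t : R) : 'cV[R]_2 :=
  x0 + cv2 (primitive (fun s => f (X (clamp s)) 0 0) t)
           (primitive (fun s => f (X (clamp s)) 1 0) t).

Lemma picard_step0 X : picard_step X 0 = x0.
Proof.
rewrite /picard_step !primitive0; apply: cv2P; rewrite !mxE/= addr0//.
Qed.

Lemma econtinuous_comp X : econtinuous X -> econtinuous (f \o X).
Proof.
move=> cX t e e0; have eL : 0 < e / L by rewrite divr_gt0.
apply: filterS (cX t _ eL) => u; rewrite ler_pdivlMr// mulrC.
exact: le_trans (fL _ _).
Qed.

Lemma picard_step_diff X t : econtinuous (X \o clamp) -> 0 <= t ->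
  diff_at (picard_step X) t (f (X t)).
Proof.
move=> cX t0; have cf := econtinuous_comp cX.
have D i : is_derive t 1 (primitive (fun s => f (X (clamp s)) i 0)) (f (X t) i 0).
  have := is_derive_primitive (@econtinuous_coord _ i cf) t0.
  by rewrite /= (clampK t0).
apply: coord_diff_at => i.
have -> : (fun s => picard_step X s i 0 : R) =
    (fun s => x0 i 0 + primitive (fun s => f (X (clamp s)) i 0) s).
  by apply/funext => s; case: (ord2P i) => ->; rewrite !mxE.
by apply: is_derive_eq; rewrite add0r mul1r.
Qed.

Lemma diff_at_clamp X (l : R -> 'cV[R]_2) :
  (forall t, 0 <= t -> diff_at X t (l t)) -> econtinuous (X \o clamp).
Proof.
move=> Xl t e e0.
apply: (@near_clamp (fun u => enorm (X u - X (clamp t)) <= e)).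
exact: diff_at_continuous (Xl _ (clamp_ge0 t)) e0.
Qed.

(** The weight exp (2 L t) makes the iteration a contraction of ratio 1/2 on
    the whole half-line. *)
Lemma picard_contraction X Y (p q : R -> 'cV[R]_2) M t :
  (forall s, 0 <= s -> diff_at X s (f (p s))) ->
  (forall s, 0 <= s -> diff_at Y s (f (q s))) -> X 0 = Y 0 ->
  0 <= M -> (forall s, 0 <= s -> enorm (p s - q s) <= M * expR (2 * L * s)) ->
  0 <= t -> enorm (X t - Y t) <= M / 2 * expR (2 * L * t).
Proof.
move=> Xp Yq XY M0 pq t0.
pose B s := M / 2 * expR (2 * L * s).
have B0 s : 0 <= B s by rewrite mulr_ge0 ?expR_ge0 ?divr_ge0.
have tX : traj 0 t X (f \o p) by apply: diff_at_traj => s s0 _; exact: Xp.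
have tY : traj 0 t Y (f \o q) by apply: diff_at_traj => s s0 _; exact: Yq.
have := @traj_growth _ B (fun s => L * (M * expR (2 * L * s))) 0 t _ _ t0 (trajB tX tY).
rewrite XY subrr subr0 => H.
apply: (@le_trans _ _ (B t - B 0)); last by rewrite gerBl.
apply: H.
- move=> s _ _ e e0; near=> r.
  have rs : r <= s by near: r; exact: nbhs_left_le.
  have : B r <= B s.
    by rewrite ler_wpM2l ?divr_ge0// ler_expR ler_wpM2l ?mulr_ge0 ?(ltW L0).
  lra.
- move=> s r s0 sr.
  have -> : B r = B s * expR (2 * L * (r - s)).
    by rewrite /B -[RHS]mulrA -expRD; congr (_ * expR _); ring.
  have := ler_wpM2l (B0 s) (expR_ge1Dx (2 * L * (r - s))).
  by apply: le_trans; rewrite /B; lra.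
- move=> s s0 _; apply: (le_trans (fL _ _)).
  by rewrite ler_wpM2l ?(ltW L0)// pq.
Unshelve. all: by end_near. Qed.

Definition picard_iter n : R -> 'cV[R]_2 := iter n picard_step (fun=> x0).

Lemma picard_iter_continuous n : econtinuous (picard_iter n \o clamp).
Proof.
elim: n => [t e e0|n IH].
  by exists 1 => //= u _; rewrite subrr enorm0 ltW.
by apply: diff_at_clamp => t t0; exact: picard_step_diff.
Qed.

Lemma picard_iter_cauchy n t : 0 <= t ->
  enorm (picard_iter n.+1 t - picard_iter n t) <=
  enorm (f x0) / (2 * L) * 2^-1 ^+ n * expR (2 * L * t).
Proof.
have L2 : 0 < 2 * L by rewrite mulr_gt0.
have B0 : 0 <= enorm (f x0) / (2 * L) by rewrite divr_ge0 ?enorm_ge0 ?ltW.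
elim: n t => [|n IH] t t0.
  have H : traj 0 t (picard_iter 1) (fun=> f x0).
    apply: diff_at_traj => s s0 _; apply: (@picard_step_diff (fun=> x0) s) => //.
    exact: (picard_iter_continuous 0).
  rewrite /= in H *.
  have := traj_lipschitz t0 H (fun _ _ _ => lexx _).
  rewrite picard_step0 subr0 => h; apply: (le_trans h).
  rewrite expr0 mulr1 -mulrA ler_wpM2l ?enorm_ge0// mulrC ler_pdivlMr//.
  by have := expR_ge1Dx (2 * L * t); lra.
have -> : enorm (f x0) / (2 * L) * 2^-1 ^+ n.+1 * expR (2 * L * t) =
    enorm (f x0) / (2 * L) * 2^-1 ^+ n / 2 * expR (2 * L * t).
  by rewrite exprSr; ring.
apply: (@picard_contraction _ _ (picard_iter n.+1) (picard_iter n)) => //.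
- by move=> s; apply: (@picard_step_diff (picard_iter n.+1));
    exact: picard_iter_continuous.
- by move=> s; apply: (@picard_step_diff (picard_iter n));
    exact: picard_iter_continuous.
- by rewrite /picard_iter !iterS !picard_step0.
- by rewrite mulr_ge0 ?exprn_ge0 ?invr_ge0.
Qed.

(** The iterates converge uniformly on bounded intervals, hence to a function Z
    whose restriction to t >= 0 is continuous; Z is a fixed point because Z and
    picard_step Z are both limits of the iterates. *)
Lemma lipschitz_global_solution :
  exists X, X 0 = x0 /\ forall t, 0 <= t -> diff_at X t (f (X t)).
Proof.
have L2 : 0 < 2 * L by rewrite mulr_gt0.
pose C := enorm (f x0) / (2 * L).
have C0 : 0 <= C by rewrite divr_ge0 ?enorm_ge0 ?ltW.
have iterC n t : 0 <= t -> enorm (picard_iter n.+1 t - picard_iter n t) <=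
    C * 2^-1 ^+ n * expR (2 * L * t) by exact: picard_iter_cauchy.
clearbody C.
have [Z ZX] : {Z : R -> 'cV[R]_2 & forall t, 0 <= t -> forall n,
    enorm (Z t - picard_iter n t) <= 4 * C * 2^-1 ^+ n * expR (2 * L * t)}.
  apply: (@choice _ _ (fun t z => 0 <= t -> forall n,
    enorm (z - picard_iter n t) <= 4 * C * 2^-1 ^+ n * expR (2 * L * t))) => t.
  have [t0|_] := leP 0 t; last by exists 0.
  have cauchy i n : `|picard_iter n.+1 t i 0 - picard_iter n t i 0| <=
      C * expR (2 * L * t) * 2^-1 ^+ n.
    have := coord_le_enorm (picard_iter n.+1 t - picard_iter n t) i.
    rewrite !mxE => h; apply: (le_trans h).
    by apply: (le_trans (iterC n t t0)); rewrite mulrAC.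
  have [l0 l0P] := geometric_cauchy_limit (cauchy 0).
  have [l1 l1P] := geometric_cauchy_limit (cauchy 1).
  exists (cv2 l0 l1) => _ n; apply: (le_trans (enorm_le_coord _)).
  by move: (l0P n) (l1P n); rewrite !mxE/=; set q := _ ^+ n; lra.
have cZ : econtinuous (Z \o clamp).
  move=> t e e0 /=.
  (* W bounds the weight up to the time clamp t + 1. *)
  pose W := 4 * C * expR (2 * L * (clamp t + 1)).
  have [n Wn] : exists n, W * 2^-1 ^+ n <= e / 3.
    apply: contrapT => /forallNP H.
    have := @le0_of_geometric (e / 3) W.
    suff : ~ (e / 3 <= 0) by move=> + h; apply; apply: h => n; move/negP: (H n); rewrite -ltNge => /ltW.
    by apply/negP; rewrite -ltNge; lra.
  have near_t : \forall u \near t, clamp u <= clamp t + 1.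
    apply: (@near_clamp (fun u => u <= clamp t + 1)).
    exists 1 => [/=|u /=]; first exact: ltr01.
    by rewrite ltr_distlC => /andP[_ /ltW].
  have e3 : 0 < e / 3 by lra.
  move: (picard_iter_continuous n t e3) near_t; apply: filterS2 => u /= hu ut.
  have ZW s : clamp s <= clamp t + 1 ->
      enorm (Z (clamp s) - picard_iter n (clamp s)) <= e / 3.
    move=> st; apply: (le_trans (ZX _ (clamp_ge0 s) n)); apply: le_trans Wn.
    rewrite /W mulrAC ler_wpM2r ?exprn_ge0 ?invr_ge0//.
    by rewrite ler_wpM2l ?mulr_ge0// ler_expR ler_wpM2l ?(ltW L2).
  have h1 := ZW u ut.
  have h2 : enorm (Z (clamp t) - picard_iter n (clamp t)) <= e / 3.
    by apply: ZW; rewrite lerDl.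
  have -> : Z (clamp u) - Z (clamp t) =
     (Z (clamp u) - picard_iter n (clamp u)) +
     ((picard_iter n (clamp u) - picard_iter n (clamp t)) -
      (Z (clamp t) - picard_iter n (clamp t))).
    by apply/matrixP => i j; rewrite !mxE; ring.
  apply: (le_trans (enormD _ _)).
  have := enormD (picard_iter n (clamp u) - picard_iter n (clamp t))
     (- (Z (clamp t) - picard_iter n (clamp t))); rewrite enormN.
  lra.
have YZ t : 0 <= t -> picard_step Z t = Z t.
  move=> t0; apply/eqP; rewrite -subr_eq0; apply/eqP/enorm_eq0/le_anti.
  rewrite enorm_ge0 andbT.
  apply: (@le0_of_geometric _ (4 * C * expR (2 * L * t))) => n.
  have h1 : enorm (picard_step Z t - picard_iter n.+1 t) <=
      4 * C * 2^-1 ^+ n / 2 * expR (2 * L * t).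
    apply: (@picard_contraction _ _ Z (picard_iter n)) => //.
    - by move=> s s0; exact: picard_step_diff.
    - by move=> s; apply: (@picard_step_diff (picard_iter n));
        exact: picard_iter_continuous.
    - by rewrite /picard_iter !iterS !picard_step0.
    - by rewrite !mulr_ge0 ?exprn_ge0 ?invr_ge0.
    - by move=> s s0; exact: ZX.
  have h2 := ZX t t0 n.+1; rewrite enormB in h2.
  have := enormD (picard_step Z t - picard_iter n.+1 t) (picard_iter n.+1 t - Z t).
  rewrite addrA subrK; move: h1 h2; rewrite exprSr.
  by set q := _ ^+ n; lra.
exists (picard_step Z); split; first exact: picard_step0.
by move=> t t0; rewrite YZ//; exact: picard_step_diff.
Qed.

End Picard.

(** McShane's extension: the infimum over y in S of h y + L |z - y|. *)
Lemma lipschitz_extension (S : set 'cV[R]_2) (h : 'cV[R]_2 -> R) (L : R) z0 :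
  S z0 -> 0 <= L ->
  (forall z z', S z -> S z' -> `|h z - h z'| <= L * enorm (z - z')) ->
  exists k : 'cV[R]_2 -> R, (forall z, S z -> k z = h z) /\
    forall z z', `|k z - k z'| <= L * enorm (z - z').
Proof.
move=> Sz0 L0 hL.
pose V z := [set h y + L * enorm (z - y) | y in S].
have tri z z' y : L * enorm (z - y) <= L * enorm (z - z') + L * enorm (z' - y).
  rewrite -mulrDr ler_wpM2l//; apply: le_trans (enormD _ _).
  by rewrite addrA subrK.
have lbV z : has_lbound (V z).
  exists (h z0 - L * enorm (z - z0)) => _ [y Sy <-].
  have := ler_norm (h z0 - h y); have := hL _ _ Sz0 Sy; have := tri z0 z y.
  by rewrite [enorm (z0 - z)]enormB; lra.
have infV z y : S y -> inf (V z) <= h y + L * enorm (z - y).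
  by move=> Sy; apply: ge_inf => //; exists y.
have nV z : V z !=set0 by exists (h z0 + L * enorm (z - z0)); exists z0.
have half z z' : inf (V z) - inf (V z') <= L * enorm (z - z').
  suff : inf (V z) - L * enorm (z - z') <= inf (V z') by lra.
  apply: lb_le_inf => // _ [y Sy <-].
  by have := infV z y Sy; have := tri z z' y; lra.
exists (fun z => inf (V z)); split => [z Sz|z z']; last first.
  rewrite ler_norml half andbT.
  by have := half z' z; rewrite enormB; lra.
apply/le_anti/andP; split.
  by have := infV z z Sz; rewrite subrr enorm0 mulr0 addr0.
apply: lb_le_inf => // _ [y Sy <-].
by have := ler_norm (h z - h y); have := hL _ _ Sz Sy; lra.
Qed.

Lemma lipschitz_field_extension (S : set 'cV[R]_2) (f : 'cV[R]_2 -> 'cV[R]_2)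
    (L : R) z0 : S z0 -> 0 <= L ->
  (forall z z', S z -> S z' -> enorm (f z - f z') <= L * enorm (z - z')) ->
  exists k : 'cV[R]_2 -> 'cV[R]_2, (forall z, S z -> k z = f z) /\
    forall z z', enorm (k z - k z') <= 2 * L * enorm (z - z').
Proof.
move=> Sz0 L0 fL.
have fi i z z' : S z -> S z' -> `|f z i 0 - f z' i 0| <= L * enorm (z - z').
  move=> Sz Sz'; apply: le_trans (fL _ _ Sz Sz').
  by have := coord_le_enorm (f z - f z') i; rewrite !mxE.
have [k0 [k0f k0L]] := lipschitz_extension Sz0 L0 (fi 0).
have [k1 [k1f k1L]] := lipschitz_extension Sz0 L0 (fi 1).
exists (fun z => cv2 (k0 z) (k1 z)); split=> [z Sz|z z'].
  by apply: cv2P; rewrite mxE/= ?k0f ?k1f.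
apply: (le_trans (enorm_le_coord _)); rewrite !mxE/=.
by have := k0L z z'; have := k1L z z'; lra.
Qed.

End Existence.

(** * The observability Gramian *)

Section Gramian.
Variable R : realType.
Implicit Types (A : 'M[R]_2) (v : 'cV[R]_2).

(** Uses exp (l t) >= 1 + l t. *)
Lemma exp_decay_cvg0 (y : R -> R) (M l : R) : 0 < l ->
  (forall t, 0 <= t -> `|y t| <= M * expR (- l * t)) ->
  y t @[t --> +oo] --> 0.
Proof.
move=> l0 yM; apply/cvgrPdist_le => /= e e0; near=> t.
have t0 : 0 <= t by near: t; apply: nbhs_pinfty_ge; exact: num_real.
have tM : M / (e * l) <= t by near: t; apply: nbhs_pinfty_ge; exact: num_real.
rewrite sub0r normrN; apply: (le_trans (yM t t0)).
rewrite mulNr expRN ler_pdivrMr ?expR_gt0//.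
move: tM; rewrite ler_pdivrMr ?mulr_gt0// => tM; apply: (le_trans tM).
rewrite mulrC -mulrA ler_pM2l//.
by have := expR_ge1Dx (l * t); lra.
Unshelve. all: by end_near. Qed.

(** The matrix P theta of the Lyapunov function is the Gramian of the frozen
    closed-loop matrix. *)
Definition gramian A : 'M[R]_2 := \matrix_(i, j)
  \int[lebesgue_measure]_(tau in `[0, +oo[)
    (mexp (tau *: A^T) *m mexp (tau *: A)) i j.

Section Companion.
(** Every closed-loop matrix has this shape, whatever the gain. *)
Variables (A : 'M[R]_2) (m l : R).
Hypotheses (A01 : A 0 1 = 1) (A11 : A 1 1 = 0).
Hypotheses (l0 : 0 < l) (Aml : decays A m l).

Local Notation a := (A 0 0).
Local Notation b := (A 1 0).
Local Notation E v t := (mexp (t *: A) *m v).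

Lemma flow_coord0 v (t : R) :
  is_derive t 1 (fun s : R => E v s 0 0 : R) (a * E v t 0 0 + E v t 1 0).
Proof. by have := mexp_is_derive A v t 0; rewrite mulmx2E A01 mul1r. Qed.

Lemma flow_coord1 v (t : R) :
  is_derive t 1 (fun s : R => E v s 1 0 : R) (b * E v t 0 0).
Proof. by have := mexp_is_derive A v t 1; rewrite mulmx2E A11 mul0r addr0. Qed.

Lemma flow_coord_cvg0 v i : E v t i 0 @[t --> +oo] --> (0 : R).
Proof.
apply: (@exp_decay_cvg0 _ (m * enorm v) l l0) => t t0.
apply: (le_trans (coord_le_enorm _ _)).
by have := Aml v t0; rewrite mulrAC.
Qed.

(** If b = 0 then the second coordinate is constant along the flow, which
    however tends to 0. *)
Lemma companion_b_neq0 : b != 0.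
Proof.
apply/negP => /eqP b0; pose v : 'cV[R]_2 := cv2 0 1.
have y1 (t : R) : E v t 1 0 = 1.
  have -> : 1 = E v 0 1 0 by rewrite scale0r mexp0 !mxE.
  apply: (@is_derive_0_is_cst _ (fun s => E v s 1 0)) => s.
  by have := flow_coord1 v s; rewrite b0 mul0r.
have := flow_coord_cvg0 v 1.
under eq_fun do rewrite y1.
move=> /(cvg_lim (@Rhausdorff R)); rewrite lim_cst//.
by move/eqP; rewrite oner_eq0.
Qed.

(** If a = 0 then b x0^2 - x1^2 is constant along the flow, which however tends
    to 0. *)
Lemma companion_a_neq0 : a != 0.
Proof.
apply/negP => /eqP a0; pose v : 'cV[R]_2 := cv2 0 1.
pose I t : R := b * (E v t 0 0 * E v t 0 0) - E v t 1 0 * E v t 1 0.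
have I1 (t : R) : I t = - 1.
  have -> : - 1 = I 0 by rewrite /I scale0r mexp0 !mxE/=; ring.
  apply: is_derive_0_is_cst => s.
  have D0 := flow_coord0 v s; have D1 := flow_coord1 v s.
  by rewrite /I; apply: is_derive_eq; rewrite /GRing.scale/= a0; ring.
have : I t @[t --> +oo] --> b * (0 * 0) - 0 * 0.
  apply: cvgB; last by apply: cvgM; exact: flow_coord_cvg0.
  by apply: cvgMl_tmp; apply: cvgM; exact: flow_coord_cvg0.
under eq_fun do rewrite I1.
move=> /(cvg_lim (@Rhausdorff R)); rewrite lim_cst// => /eqP.
by rewrite !mul0r mulr0 subrr oppr_eq0 oner_eq0.
Qed.

(** For a matrix of this shape the equation A^T P + P A = -1 is triangular in
    the entries of P: its lower right entry determines P 0 1, the upper left one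
    then determines P 0 0, and the last one P 1 1. *)
Definition lyap_sol : 'M[R]_2 :=
  let p := (b - 1) / (2 * a) in
  \matrix_(i, j) (nth [::] [:: [:: p; - 2^-1]; [:: - 2^-1; (a / 2 - p) / b]] i)`_j.

Lemma lyap_sol_eq v :
  bilin lyap_sol v (A *m v) + bilin lyap_sol (A *m v) v = - enorm v ^+ 2.
Proof.
rewrite !bilinE !mulmx2E A01 A11 enorm_sqr !mxE/=.
by field; rewrite companion_a_neq0 companion_b_neq0.
Qed.

Lemma continuous_flow_sqr v : continuous (fun t : R => enorm (E v t) ^+ 2).
Proof.
move=> t.
have -> : (fun t => enorm (E v t) ^+ 2) =
  (fun t => E v t 0 0 * E v t 0 0 + E v t 1 0 * E v t 1 0).
  by apply/funext => s; rewrite enorm_sqr !expr2.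
have cE i : {for t, continuous (fun t : R => E v t i 0 : R)}.
  apply: differentiable_continuous; apply/derivable1_diffP.
  exact: (@ex_derive _ _ _ _ _ _ _ (mexp_is_derive A v t i)).
by apply: cvgD; apply: cvgM; exact: cE.
Qed.

(** - x^T P x is a primitive of |x|^2 along the flow, and tends to 0. *)
Lemma integral_flow v :
  (\int[lebesgue_measure]_(t in `[0%R, +oo[) (enorm (E v t) ^+ 2)%:E =
   (bilin lyap_sol v v)%:E)%E.
Proof.
pose F t : R := - (bilin lyap_sol (E v t) (E v t)).
have FE t : F t = - (lyap_sol 0 0 * (E v t 0 0 * E v t 0 0) +
    (lyap_sol 0 1 + lyap_sol 1 0) * (E v t 0 0 * E v t 1 0) +
    lyap_sol 1 1 * (E v t 1 0 * E v t 1 0)).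
  by rewrite /F bilinE !mulmx2E; ring.
have DF (t : R) : is_derive t 1 F (enorm (E v t) ^+ 2).
  have D0 := flow_coord0 v t; have D1 := flow_coord1 v t.
  have -> : F = fun t => - (lyap_sol 0 0 * (E v t 0 0 * E v t 0 0) +
    (lyap_sol 0 1 + lyap_sol 1 0) * (E v t 0 0 * E v t 1 0) +
    lyap_sol 1 1 * (E v t 1 0 * E v t 1 0)) by apply/funext => s; exact: FE.
  apply: is_derive_eq; rewrite -[RHS]opprK -lyap_sol_eq.
  by rewrite !bilinE !mulmx2E A01 A11 /GRing.scale/=; ring.
rewrite (@ge0_continuous_FTC2y _ _ F 0 0).
- by rewrite /F scale0r mexp0 sub0e EFinN oppeK.
- by move=> x _; exact: sqr_ge0.
- by apply: continuous_subspaceT; exact: continuous_flow_sqr.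
- have -> : (0 : R) = - (lyap_sol 0 0 * (0 * 0) +
    (lyap_sol 0 1 + lyap_sol 1 0) * (0 * 0) + lyap_sol 1 1 * (0 * 0)) by ring.
  have -> : F = fun t => - (lyap_sol 0 0 * (E v t 0 0 * E v t 0 0) +
    (lyap_sol 0 1 + lyap_sol 1 0) * (E v t 0 0 * E v t 1 0) +
    lyap_sol 1 1 * (E v t 1 0 * E v t 1 0)) by apply/funext => s; exact: FE.
  by apply: cvgN; apply: cvgD; [apply: cvgD|]; apply: cvgMl_tmp;
    apply: cvgM; exact: flow_coord_cvg0.
- by move=> x _; exact: (@ex_derive _ _ _ _ _ _ _ (DF x)).
- apply: cvg_at_right_filter; apply: differentiable_continuous.
  apply/derivable1_diffP; exact: (@ex_derive _ _ _ _ _ _ _ (DF 0)).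
- move=> x _; rewrite derive1E; exact: (@derive_val _ _ _ _ _ _ _ (DF x)).
Qed.

Lemma integrable_flow v : lebesgue_measure.-integrable `[0, +oo[
  (EFin \o (fun t : R => enorm (E v t) ^+ 2)).
Proof.
apply/integrableP; split.
  apply/measurable_EFinP; apply: measurable_funTS.
  by apply: continuous_measurable_fun; exact: continuous_flow_sqr.
rewrite [X in (X < _)%E](_ : _ = (bilin lyap_sol v v)%:E) ?ltry//.
rewrite -integral_flow; congr integral; apply/funext => t /=.
by rewrite ger0_norm ?sqr_ge0.
Qed.

(** By polarization, since integral_flow only concerns the diagonal integrands,
    which are nonnegative. *)
Lemma gramianE : gramian A = lyap_sol.
Proof.
pose e (i : 'I_2) : 'cV[R]_2 := delta_mx i 0.
apply/matrixP => i j; rewrite [LHS]mxE.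
have polar (t : R) : (mexp (t *: A^T) *m mexp (t *: A)) i j =
  2^-1 * (enorm (E (e i + e j) t) ^+ 2 - enorm (E (e i) t) ^+ 2
          - enorm (E (e j) t) ^+ 2).
  have EE k n : E (e k) t n 0 = mexp (t *: A) n k.
    by rewrite -colE mxE.
  have ED n : (E (e i) t + E (e j) t) n 0 = mexp (t *: A) n i + mexp (t *: A) n j.
    by rewrite mxE !EE.
  by rewrite mexp_trmx mxE sum2 ![_^T _ _]mxE !enorm_sqr mulmxDr !ED !EE; field.
transitivity (\int[lebesgue_measure]_(t in `[0, +oo[)
    (2^-1 * (enorm (E (e i + e j) t) ^+ 2 - enorm (E (e i) t) ^+ 2
             - enorm (E (e j) t) ^+ 2))).
  by congr Rintegral; apply/funext => t; exact: polar.
have intB (f g : R -> R) :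
    lebesgue_measure.-integrable `[0, +oo[ (EFin \o f) ->
    lebesgue_measure.-integrable `[0, +oo[ (EFin \o g) ->
    lebesgue_measure.-integrable `[0, +oo[ (EFin \o (fun t => f t - g t)).
  move=> fi gi.
  have -> : EFin \o (fun t : R => f t - g t) = ((EFin \o f) \- (EFin \o g))%E.
    by apply/funext => t /=; rewrite EFinB.
  exact: integrableB.
have I := integrable_flow.
have I2 := intB _ _ (I (e i + e j)) (I (e i)).
have I3 := intB _ _ I2 (I (e j)).
have mD : measurable (`[0, +oo[ : set R) by exact: measurable_itv.
pose mu := @lebesgue_measure R.
rewrite (@RintegralZl _ _ _ mu _ _ _ mD I3).
rewrite (@RintegralB _ _ _ mu _ _ _ mD I2 (I _)).
rewrite (@RintegralB _ _ _ mu _ _ _ mD (I _) (I _)).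
have eE k n : e k n 0 = (n == k)%:R by rewrite mxE andbT.
have eD n : (e i + e j) n 0 = (n == i)%:R + (n == j)%:R by rewrite mxE !eE.
have Psym : lyap_sol 1 0 = lyap_sol 0 1 by rewrite !mxE.
rewrite /Rintegral !integral_flow/= !bilinE !mulmx2E !eD !eE.
by case: (ord2P i) (ord2P j) => -> [->|->]; rewrite /= ?Psym; field.
Qed.

Lemma gramian_lyapunov v :
  bilin (gramian A) v (A *m v) + bilin (gramian A) (A *m v) v = - enorm v ^+ 2.
Proof. by rewrite gramianE lyap_sol_eq. Qed.

End Companion.

End Gramian.

(** * The closed loop *)

Section Composition.
Variable R : realType.
Implicit Types (x v : R -> 'cV[R]_2).

(** The chain rule for one-sided derivatives. J y0 is the differential of g at
    y0, and a quadratic remainder with a constant that depends on y0 suffices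
    for polynomial maps. *)
Lemma traj_comp (g : 'cV[R]_2 -> 'cV[R]_2) (J : 'cV[R]_2 -> 'cV[R]_2 -> 'cV[R]_2)
    (a b : R) x v :
  (forall y0, exists M, [/\ 0 <= M,
     forall y, enorm (g y - g y0 - J y0 (y - y0)) <= M * enorm (y - y0) ^+ 2,
     forall w w', enorm (J y0 w - J y0 w') <= M * enorm (w - w') &
     forall h w, J y0 (h *: w) = h *: J y0 w]) ->
  traj a b x v -> traj a b (g \o x) (fun t => J (x t) (v t)).
Proof.
move=> gJ xv; have [xl xr] := xv; split=> t at_ tb e e0.
- have [M [M0 gM JM JZ]] := gJ (x t).
  pose e1 := Num.min 1 (e / (2 * M + 1)).
  have M1 : 0 < 2 * M + 1 by lra.
  have e10 : 0 < e1 by rewrite lt_min ltr01 divr_gt0.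
  have e11 : e1 <= 1 by rewrite ge_min lexx.
  have e1e : e1 * (2 * M + 1) <= e by rewrite -ler_pdivlMr// ge_min lexx orbT.
  apply: filterS (xl t at_ tb e1 e10) => s xs /=.
  have h1 := gM (x s).
  have h2 := JM (x s - x t) 0.
  have J0 : J (x t) 0 = 0 by rewrite -(scale0r 0) JZ !scale0r.
  rewrite J0 !subr0 in h2.
  have h3 : g (x s) - g (x t) =
    (g (x s) - g (x t) - J (x t) (x s - x t)) + J (x t) (x s - x t).
    by rewrite subrK.
  rewrite h3; apply: (le_trans (enormD _ _)).
  have n0 := enorm_ge0 (x s - x t); set n := enorm (x s - x t) in n0 xs h1 h2 *.
  have : n ^+ 2 <= e1 by rewrite expr2 -[e1]mulr1 ler_pM// (le_trans xs).
  move=> n2; have := ler_wpM2l M0 n2; have := ler_wpM2l M0 xs.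
  lra.
- have [M [M0 gM JM JZ]] := gJ (x t).
  pose k := enorm (v t) + 2.
  have k0 : 0 < k by rewrite ltr_wpDl ?enorm_ge0.
  pose e1 := Num.min 1 (e / (M * k + 1)).
  have M1 : 0 < M * k + 1 by rewrite ltr_wpDl// mulr_ge0// ltW.
  have e10 : 0 < e1 by rewrite lt_min ltr01 divr_gt0.
  have e11 : e1 <= 1 by rewrite ge_min lexx.
  have e1e : e1 * (M * k + 1) <= e by rewrite -ler_pdivlMr// ge_min lexx orbT.
  have xc := traj_right_continuous xv at_ tb e10.
  have xd := xr t at_ tb e1 e10.
  near=> u => /=.
  have tu : t < u by near: u; exact: nbhs_right_gt.
  have xcu : enorm (x u - x t) <= e1 by near: u.
  have xdu : enorm (x u - x t - (u - t) *: v t) <= e1 * (u - t) by near: u.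
  have h0 : 0 < u - t by rewrite subr_gt0.
  have h1 := gM (x u); have h2 := JM (x u - x t) ((u - t) *: v t).
  rewrite JZ in h2.
  have -> : g (x u) - g (x t) - (u - t) *: J (x t) (v t) =
    (g (x u) - g (x t) - J (x t) (x u - x t)) +
    (J (x t) (x u - x t) - (u - t) *: J (x t) (v t)).
    by rewrite addrA subrK.
  apply: (le_trans (enormD _ _)).
  have n0 := enorm_ge0 (x u - x t).
  have n1 : enorm (x u - x t) <= (u - t) * (k - 1).
    rewrite -[x u - x t](subrK ((u - t) *: v t)).
    apply: (le_trans (enormD _ _)); rewrite enormZ gtr0_norm// /k.
    have := ler_wpM2r (ltW h0) e11; lra.
  set n := enorm (x u - x t) in n0 xcu h1 n1 *.
  have n2 : n ^+ 2 <= e1 * ((u - t) * (k - 1)) by rewrite expr2 ler_pM.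
  have h3 := ler_wpM2l M0 n2; have h4 := ler_wpM2l M0 xdu.
  have h5 := ler_wpM2r (ltW h0) e1e.
  have : 0 <= e1 * (u - t) by rewrite mulr_ge0 ?ltW.
  lra.
Unshelve. all: by end_near. Qed.

(** Stability in the first approximation: in the ball of radius r the error
    costs half of the rate l, and m |x 0| < r keeps the trajectory in that
    ball. *)
Lemma linearized_decay (A : 'M[R]_2) (m l r b : R) x v :
  1 <= m -> 0 < l -> decays A m l -> 0 <= b -> traj 0 b x v ->
  (forall t, 0 <= t -> t < b -> enorm (x t) < r ->
     enorm (v t - A *m x t) <= l / (2 * m) * enorm (x t)) ->
  m * enorm (x 0) < r ->
  enorm (x b) <= m * expR (- (l / 2) * b) * enorm (x 0).
Proof.
move=> m1 l0 Aml b0 xv xA x0r.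
have m0 : 0 < m by exact: lt_le_trans m1.
have bound t : 0 <= t -> t <= b -> (forall s, 0 <= s -> s < t -> enorm (x s) < r) ->
    enorm (x t) <= m * expR (- (l / 2) * t) * enorm (x 0).
  move=> t0 tb xr.
  have := @perturbed_decay _ A m l (l / (2 * m)) 0 t x v m1.
  have -> : (m * (l / (2 * m)) - l) * (t - 0) = - (l / 2) * t.
    by field; rewrite gt_eqF.
  apply=> //; first by rewrite divr_ge0 ?mulr_ge0 ?ltW.
    exact: traj_sub xv.
  by move=> s s0 st; apply: xA => //; [exact: lt_le_trans tb|exact: xr].
have lt_r t : 0 <= t -> enorm (x t) <= m * expR (- (l / 2) * t) * enorm (x 0) ->
    enorm (x t) < r.
  move=> t0 xt; apply: le_lt_trans x0r; apply: (le_trans xt).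
  rewrite -mulrA ler_pM2l// ler_piMl ?enorm_ge0// -expR0 ler_expR.
  by rewrite mulNr oppr_le0 mulr_ge0// divr_ge0// ltW.
apply: (bound b) => // s s0 sb.
apply: (@real_induction _ 0 b (fun t => enorm (x t) < r)) => //; last exact: ltW.
- by apply: le_lt_trans x0r; rewrite ler_peMl ?enorm_ge0.
- move=> t t0 tb xt.
  have xtr : 0 < (r - enorm (x t)) / 2 by have := xt t t0 (lexx _); lra.
  apply: filterS (traj_right_continuous xv t0 tb xtr) => u xu.
  have := enorm_sub (x u) (x t); have := xt t t0 (lexx _); lra.
- by move=> t t0 tb xt; apply: lt_r; [exact: ltW|apply: (bound t) => //; exact: ltW].
Qed.

End Composition.

Section ClosedLoop.
Variables (R : realType) (p : missile R) (K : 'cV[R]_2 -> R).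
Implicit Types (x y w theta : 'cV[R]_2).

Local Notation f := (closed_loop p K).
Local Notation A := (Acl p K).
Local Notation ph := (phi p).

Lemma Acl01 theta : A theta 0 1 = 1.
Proof. by rewrite !mxE/= big_ord1 !mxE/= mulr0 addr0. Qed.

Lemma Acl11 theta : A theta 1 1 = 0.
Proof. by rewrite !mxE/= big_ord1 !mxE/= mulr0 addr0. Qed.

(** The differential of phi at x. *)
Definition dphi x w : 'cV[R]_2 :=
  cv2 (kappa_alpha p * mach p * (2 * a_n p * x 0 0 + b_n p) * w 0 0)
      (kappa_q p * mach p * (2 * a_m p * x 0 0 + b_m p) * w 0 0).

Lemma psi_dphi x : psi p K x = dphi x (f x).
Proof.
suff E : f x 0 0 = ph x 0 0 * x 0 0 + x 1 0 +
    kappa_alpha p * mach p * d_n p * K (ph x) * x 0 0.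
  by rewrite /dphi E.
rewrite /closed_loop mulmx2E Acl01 mul1r.
have -> theta : A theta 0 0 =
    theta 0 0 + kappa_alpha p * mach p * d_n p * K theta.
  by rewrite !mxE/= big_ord1 !mxE/= big_ord1 !mxE/= mulr1n mulr1.
by ring.
Qed.

Lemma phi_traj (a b : R) (x v : R -> 'cV[R]_2) : traj a b x v ->
  traj a b (ph \o x) (fun t => dphi (x t) (v t)).
Proof.
apply: traj_comp => y0.
pose M0 := `|kappa_alpha p * mach p * a_n p| + `|kappa_q p * mach p * a_m p|.
pose M1 := `|kappa_alpha p * mach p * (2 * a_n p * y0 0 0 + b_n p)| +
  `|kappa_q p * mach p * (2 * a_m p * y0 0 0 + b_m p)|.
have M00 : 0 <= M0 by rewrite addr_ge0.
have M10 : 0 <= M1 by rewrite addr_ge0.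
exists (M0 + M1); split; first exact: addr_ge0.
- move=> y; apply: (le_trans (enorm_le_coord _)).
  have := coord_le_enorm (y - y0) 0; rewrite !mxE/= => yn.
  set n := enorm (y - y0) in yn *.
  apply: (@le_trans _ _ (M0 * n ^+ 2)); last first.
    by rewrite ler_wpM2r ?sqr_ge0// lerDl.
  have sq : (y 0 0 - y0 0 0) ^+ 2 <= n ^+ 2.
    by rewrite -[leLHS]real_normK ?num_real// lerXn2r ?nnegrE ?enorm_ge0.
  have quad c a2 a1 a0 : `|c * (a2 * y 0 0 ^+ 2 + a1 * y 0 0 + a0) -
      c * (a2 * y0 0 0 ^+ 2 + a1 * y0 0 0 + a0) -
      c * (2 * a2 * y0 0 0 + a1) * (y 0 0 - y0 0 0)| <= `|c * a2| * n ^+ 2.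
    have -> : c * (a2 * y 0 0 ^+ 2 + a1 * y 0 0 + a0) -
      c * (a2 * y0 0 0 ^+ 2 + a1 * y0 0 0 + a0) -
      c * (2 * a2 * y0 0 0 + a1) * (y 0 0 - y0 0 0) =
      c * a2 * (y 0 0 - y0 0 0) ^+ 2 by ring.
    by rewrite normrM (ger0_norm (sqr_ge0 _)) ler_wpM2l.
  by apply: (le_trans (lerD (quad _ _ _ _) (quad _ _ _ _))); rewrite -mulrDl.
- move=> w w'; apply: (le_trans (enorm_le_coord _)).
  have := coord_le_enorm (w - w') 0; rewrite !mxE/= -!mulrBr => wn.
  apply: (@le_trans _ _ (M1 * enorm (w - w'))); last first.
    by rewrite ler_wpM2r ?enorm_ge0// lerDr.
  by rewrite !normrM -!mulrDl -!normrM ler_pM ?addr_ge0.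
- by move=> h w; apply: cv2P; rewrite !mxE/=; ring.
Qed.

Lemma phi_lipschitz (rho : R) : 0 <= rho -> exists2 L, 0 <= L &
  forall x y, enorm x <= rho -> enorm y <= rho ->
    enorm (ph x - ph y) <= L * enorm (x - y).
Proof.
move=> rho0.
pose L0 := `|kappa_alpha p * mach p| * (`|a_n p| * (2 * rho) + `|b_n p|).
pose L1 := `|kappa_q p * mach p| * (`|a_m p| * (2 * rho) + `|b_m p|).
exists (L0 + L1).
  by rewrite addr_ge0// mulr_ge0// addr_ge0// mulr_ge0// mulr_ge0.
move=> x y xr yr; apply: (le_trans (enorm_le_coord _)).
have := coord_le_enorm (x - y) 0; rewrite !mxE/= => xyn.
have ar : `|x 0 0| <= rho by exact: le_trans (coord_le_enorm _ _) xr.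
have br : `|y 0 0| <= rho by exact: le_trans (coord_le_enorm _ _) yr.
have quad c a2 a1 a0 : `|c * (a2 * x 0 0 ^+ 2 + a1 * x 0 0 + a0) -
      c * (a2 * y 0 0 ^+ 2 + a1 * y 0 0 + a0)| <=
      `|c| * (`|a2| * (2 * rho) + `|a1|) * enorm (x - y).
  have -> : c * (a2 * x 0 0 ^+ 2 + a1 * x 0 0 + a0) -
      c * (a2 * y 0 0 ^+ 2 + a1 * y 0 0 + a0) =
      c * (a2 * (x 0 0 + y 0 0) + a1) * (x 0 0 - y 0 0) by ring.
  rewrite !normrM ler_pM ?mulr_ge0// ler_wpM2l//.
  apply: (le_trans (ler_normD _ _)); rewrite lerD2r normrM ler_wpM2l//.
  by apply: (le_trans (ler_normD _ _)); lra.
by apply: (le_trans (lerD (quad _ _ _ _) (quad _ _ _ _))); rewrite -mulrDl.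
Qed.

Section Domain.
Variables (D : set 'cV[R]_2) (LA m l : R).
Local Notation E := (theta_set p D).
Hypothesis D0 : D 0.
Hypothesis ALA : forall theta theta', E theta -> E theta' ->
  opnorm (A theta - A theta') <= LA * enorm (theta - theta').
Hypotheses (m1 : 1 <= m) (l0 : 0 < l).
Hypothesis Aml : forall theta, E theta -> decays (A theta) m l.

Let m0 : 0 < m. Proof. exact: lt_le_trans m1. Qed.

Lemma E_phi x : D x -> E (ph x).
Proof. by move=> Dx; exists x. Qed.

Lemma Acl_diff x y w : D x -> D y ->
  enorm ((A (ph x) - A (ph y)) *m w) <= `|LA| * enorm (ph x - ph y) * enorm w.
Proof.
move=> Dx Dy; apply: (le_trans (enorm_mulmx _ _)).
rewrite ler_wpM2r ?enorm_ge0//; apply: (le_trans (ALA (E_phi Dx) (E_phi Dy))).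
by rewrite ler_wpM2r ?enorm_ge0// ler_norm.
Qed.

(** A (phi x) is Lipschitz, hence also bounded, on bounded parts of D. *)
Lemma closed_loop_lipschitz (rho : R) : 0 <= rho -> exists2 L, 0 <= L &
  forall x y, D x -> D y -> enorm x <= rho -> enorm y <= rho ->
    enorm (f x - f y) <= L * enorm (x - y).
Proof.
move=> rho0; have [L L0 phL] := phi_lipschitz rho0.
pose M := opnorm (A (ph 0)) + `|LA| * (L * rho).
exists (M + `|LA| * L * rho).
  by rewrite !addr_ge0 ?opnorm_ge0 ?mulr_ge0.
move=> x y Dx Dy xr yr.
have -> : f x - f y = A (ph 0) *m (x - y) +
    (A (ph x) - A (ph 0)) *m (x - y) + (A (ph x) - A (ph y)) *m y.
  rewrite /closed_loop !mulmxBl !mulmxBr.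
  move: (A _ *m x) (A _ *m y) (A (ph 0) *m x) (A (ph 0) *m y) (A _ *m y).
  by move=> q1 q2 q3 q4 q5; apply/matrixP => i j; rewrite !mxE; ring.
apply: (le_trans (enormD _ _)); rewrite mulrDl.
apply: lerD.
  apply: (le_trans (enormD _ _)); rewrite mulrDl; apply: lerD.
    exact: enorm_mulmx.
  apply: (le_trans (Acl_diff _ Dx D0)).
  rewrite ler_wpM2r ?enorm_ge0// ler_wpM2l//.
  have := phL x 0 xr; rewrite enorm0 subr0 => /(_ rho0) h; apply: (le_trans h).
  exact: ler_wpM2l.
apply: (le_trans (Acl_diff _ Dx Dy)).
apply: (@le_trans _ _ (`|LA| * (L * enorm (x - y)) * rho)); last lra.
by rewrite ler_pM ?mulr_ge0 ?enorm_ge0// ler_wpM2l// phL.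
Qed.

(** The nonlinear part (A (phi x) - A (phi 0)) x is at most |LA| L |x|^2, which
    is l |x| / (2 m) or less as soon as |x| <= q. *)
Lemma closed_loop_exp_stable r : 0 < r -> (forall x, enorm x < r -> D x) ->
  exp_stable f.
Proof.
move=> r0 rD; have [L L0 phL] := phi_lipschitz ler01.
pose q := l / (2 * m) / (`|LA| * L + 1).
have q0 : 0 < q by rewrite !divr_gt0 ?mulr_gt0// ltr_wpDl// mulr_ge0.
pose s := Num.min r (Num.min 1 q).
have s0 : 0 < s by rewrite !lt_min r0 ltr01 q0.
have sD x : enorm x < s -> D x.
  by move=> xs; apply: rD; apply: lt_le_trans xs _; rewrite ge_min lexx.
have lin x : enorm x < s ->
    enorm (f x - A (ph 0) *m x) <= l / (2 * m) * enorm x.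
  move=> xs; rewrite -mulmxBl; apply: (le_trans (Acl_diff _ (sD _ xs) D0)).
  rewrite ler_wpM2r ?enorm_ge0//.
  have x1 : enorm x <= 1.
    by apply: ltW; apply: lt_le_trans xs _; rewrite !ge_min lexx orbT.
  have xq : enorm x <= q.
    by apply: ltW; apply: lt_le_trans xs _; rewrite !ge_min lexx !orbT.
  have := phL x 0 x1; rewrite enorm0 subr0 => /(_ ler01) h.
  have := ler_wpM2l (normr_ge0 LA) h.
  move: xq; rewrite /q ler_pdivlMr; last by rewrite ltr_wpDl// mulr_ge0.
  by have := enorm_ge0 x; lra.
have decay (b : R) (x v : R -> 'cV[R]_2) : 0 <= b -> traj 0 b x v ->
    (forall t, 0 <= t -> t < b -> enorm (x t) < s -> v t = f (x t)) ->
    m * enorm (x 0) < s ->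
    enorm (x b) <= m * expR (- (l / 2) * b) * enorm (x 0).
  move=> b0 xv vf x0s.
  apply: (linearized_decay m1 l0 (Aml (E_phi D0)) b0 xv _ x0s).
  by move=> t t0 tb xs; rewrite (vf t t0 tb xs) lin.
have small (b : R) (x : R -> 'cV[R]_2) : 0 <= b ->
    enorm (x b) <= m * expR (- (l / 2) * b) * enorm (x 0) ->
    m * enorm (x 0) < s -> enorm (x b) < s.
  move=> b0 xb; apply: le_lt_trans; apply: (le_trans xb).
  rewrite -mulrA ler_pM2l// ler_piMl ?enorm_ge0// -expR0 ler_expR.
  by rewrite mulNr oppr_le0 mulr_ge0// divr_ge0// ltW.
exists (s / m), m, (l / 2); split; [by rewrite divr_gt0|by []|by rewrite divr_gt0|].
move=> x0; rewrite ltr_pdivlMr// mulrC => x0s; split.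
  have [L' L'0 fL] := closed_loop_lipschitz (ltW s0).
  pose S : set 'cV[R]_2 := [set x | enorm x < s].
  have S0 : S 0 by rewrite /S /mkset enorm0.
  have fS z z' : S z -> S z' -> enorm (f z - f z') <= L' * enorm (z - z').
    by move=> Sz Sz'; apply: fL; try exact: sD; exact: ltW.
  have [k [kf kL]] := lipschitz_field_extension S0 L'0 fS.
  have L1 : 0 < 2 * L' + 1 by rewrite ltr_wpDl// mulr_ge0.
  have kL1 z z' : enorm (k z - k z') <= (2 * L' + 1) * enorm (z - z').
    by apply: (le_trans (kL z z')); rewrite ler_wpM2r ?enorm_ge0// lerDl.
  have [X [X0 Xk]] := lipschitz_global_solution x0 L1 kL1.
  exists X; split=> //; apply: diff_at_solution => t t0.
  suff St : S (X t) by rewrite -(kf _ St); exact: Xk.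
  apply: small => //; last by rewrite X0.
  apply: (@decay t X (k \o X)) => //; last by rewrite X0.
    by apply: diff_at_traj => r' r'0 _; exact: Xk.
  by move=> r' r'0 r't Xs /=; exact: kf.
move=> T y yf y0 t t0 tT; rewrite -y0.
apply: (@decay t y (f \o y)) => //; last by rewrite y0.
exact: solution_traj yf tT.
Qed.

End Domain.
End ClosedLoop.

(** * The estimate of the attraction domain *)

Section Attraction.
Variables (R : realType) (p : missile R) (K : 'cV[R]_2 -> R).
Variables (D : set 'cV[R]_2) (P : 'cV[R]_2 -> 'M[R]_2) (LA LP m l c : R).
Implicit Types (x y w theta : 'cV[R]_2) (X v : R -> 'cV[R]_2).

Local Notation f := (closed_loop p K).
Local Notation A := (Acl p K).
Local Notation ph := (phi p).
Local Notation E := (theta_set p D).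

Hypothesis D0 : D 0.
Hypothesis ALA : forall theta theta', E theta -> E theta' ->
  opnorm (A theta - A theta') <= LA * enorm (theta - theta').
Hypotheses (m1 : 1 <= m) (l0 : 0 < l).
Hypothesis Aml : forall theta, E theta -> decays (A theta) m l.
Hypothesis LP0 : 0 < LP.
Hypothesis PLP : forall theta theta', E theta -> E theta' ->
  opnorm (P theta - P theta') <= LP * enorm (theta - theta').
Hypothesis P_lyap : forall theta x, E theta ->
  bilin (P theta) x (A theta *m x) + bilin (P theta) (A theta *m x) x =
  - enorm x ^+ 2.
Hypothesis c0 : 0 < c.
Hypothesis W_sub : forall theta x, E theta -> bilin (P theta) x x < c ->
  D x /\ enorm (psi p K x) < LP^-1.

Let m0 : 0 < m. Proof. exact: lt_le_trans m1. Qed.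

(** W (phi 0) is an open set that contains 0. *)
Lemma D_nbhs : exists2 r, 0 < r & forall x, enorm x < r -> D x.
Proof.
pose q := opnorm (P (ph 0)) + 1.
have q0 : 0 < q by rewrite ltr_wpDl ?opnorm_ge0.
exists (Num.min 1 (c / q)); first by rewrite lt_min ltr01 divr_gt0.
move=> x; rewrite lt_min ltr_pdivlMr// => /andP[x1 xq].
apply: (proj1 (@W_sub (ph 0) x (E_phi p D0) _)).
apply: le_lt_trans xq; apply: (le_trans (bilin_le _ _ _)).
have n0 := enorm_ge0 x.
have : enorm x * enorm x <= enorm x by rewrite ler_piMl// ltW.
move=> /(ler_wpM2l (opnorm_ge0 (P (ph 0)))); rewrite /q; lra.
Qed.

(** The Lyapunov function x^T P (phi x) x. Its change along a trajectory is
    - |x|^2 from the frozen Lyapunov equation plus at most LP |psi x| |x|^2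
    <= |x|^2 from the variation of P, which is merely Lipschitz. *)
Definition lyap x : R := bilin (P (ph x)) x x.

Lemma lyap_split x y : lyap x - lyap y =
  bilin (P (ph x) - P (ph y)) x x + (bilin (P (ph y)) x x - bilin (P (ph y)) y y).
Proof. by rewrite /lyap bilinBl addrA subrK. Qed.

Lemma variation_le x y w : D x -> D y ->
  bilin (P (ph x) - P (ph y)) w w <= LP * enorm (ph x - ph y) * enorm w ^+ 2.
Proof.
move=> Dx Dy; apply: (le_trans (bilin_le _ _ _)).
by rewrite expr2 ler_wpM2r ?mulr_ge0 ?enorm_ge0// PLP//; exact: E_phi.
Qed.

Lemma lyap_left a b X v t e : traj a b X v -> a < t -> t <= b -> D (X t) -> 0 < e ->
  \forall s \near t^'-, D (X s) -> lyap (X t) <= lyap (X s) + e.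
Proof.
move=> Xv at_ tb Dt e0.
pose n := enorm (X t).
have n0 : 0 <= n by exact: enorm_ge0.
pose q := LP * (n + 1) ^+ 2 + opnorm (P (ph (X t))) * (2 * n + 1).
have q0 : 0 <= q.
  by rewrite addr_ge0// mulr_ge0 ?(ltW LP0) ?sqr_ge0 ?opnorm_ge0//; lra.
pose e1 := Num.min 1 (e / (q + 1)).
have q1 : 0 < q + 1 by lra.
have e10 : 0 < e1 by rewrite lt_min ltr01 divr_gt0.
have e11 : e1 <= 1 by rewrite ge_min lexx.
have e1e : e1 * (q + 1) <= e by rewrite -ler_pdivlMr// ge_min lexx orbT.
have [Xl _] := Xv; have [phl _] := phi_traj p Xv.
move: (Xl t at_ tb e1 e10) (phl t at_ tb e1 e10).
apply: filterS2 => s Xs /= phs Ds; rewrite enormB in Xs; rewrite enormB in phs.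
have sn : enorm (X s) <= n + 1.
  by have := enorm_sub (X s) (X t); rewrite [enorm (X s - X t)]enormB -/n; lra.
have h1 : lyap (X t) - lyap (X s) <= e1 * q.
  have -> : lyap (X t) - lyap (X s) = bilin (P (ph (X t)) - P (ph (X s))) (X s) (X s)
      + (bilin (P (ph (X t))) (X t) (X t) - bilin (P (ph (X t))) (X s) (X s)).
    by rewrite /lyap bilinBl; ring.
  rewrite /q mulrDr; apply: lerD.
    apply: (le_trans (variation_le _ Dt Ds)).
    rewrite [leRHS]mulrCA -[leLHS]mulrA ler_pM2l//.
    apply: ler_pM; rewrite ?enorm_ge0 ?sqr_ge0//.
    by rewrite ler_sqr ?nnegrE ?enorm_ge0//; lra.
  apply: (le_trans (quad_diff _ _ _)).
  rewrite [leRHS]mulrCA ler_wpM2l ?opnorm_ge0// ler_pM ?addr_ge0 ?enorm_ge0//.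
  by rewrite -/n; lra.
by have := ltW e10; lra.
Qed.

Lemma lyap_right a b X v t e : traj a b X v -> a <= t -> t < b -> v t = f (X t) ->
  D (X t) -> LP * enorm (psi p K (X t)) <= 1 -> 0 < e ->
  \forall u \near t^'+, D (X u) -> lyap (X u) <= lyap (X t) + e * (u - t).
Proof.
move=> Xv at_ tb vf Dt psi1 e0.
set y := X t in vf Dt psi1.
pose n := enorm y; pose k := enorm (f y).
have n0 : 0 <= n by exact: enorm_ge0.
have k0 : 0 <= k by exact: enorm_ge0.
pose o := opnorm (P (ph y)).
have o0 : 0 <= o by exact: opnorm_ge0.
(* q is the total coefficient of e1, the accuracy to which X and phi o X are
   replaced with their tangents. *)
pose q := 2 * n + 1 + LP * (n + 1) ^+ 2 + o * (2 * n + k + 1).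
have LPn : 0 <= LP * (n + 1) ^+ 2 by rewrite mulr_ge0 ?(ltW LP0) ?sqr_ge0.
have q0 : 0 < q.
  have : 0 <= o * (2 * n + k + 1) by rewrite mulr_ge0//; lra.
  by rewrite /q; lra.
pose e1 := Num.min 1 (e / q).
have e10 : 0 < e1 by rewrite lt_min ltr01 divr_gt0.
have e11 : e1 <= 1 by rewrite ge_min lexx.
have e1e : e1 * q <= e by rewrite -ler_pdivlMr// ge_min lexx orbT.
have [_ Xr] := Xv; have [_ phr] := phi_traj p Xv.
have Xr1 := Xr t at_ tb e1 e10; have phr1 := phr t at_ tb e1 e10.
have Xc := traj_right_continuous Xv at_ tb e10.
near=> u => Du.
have tu : t < u by near: u; exact: nbhs_right_gt.
have h0 : 0 < u - t by rewrite subr_gt0.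
have H1 : enorm (X u - y - (u - t) *: v t) <= e1 * (u - t) by near: u.
have H2 : enorm (ph (X u) - ph y - (u - t) *: dphi p y (v t)) <= e1 * (u - t).
  by near: u.
have H3 : enorm (X u - y) <= e1 by near: u.
move: (u - t) h0 H1 H2 => h h0; rewrite vf -psi_dphi => H1 H2.
have dh : enorm (X u - y) <= h * (k + 1).
  rewrite -[X u - y](subrK (h *: f y)); apply: (le_trans (enormD _ _)).
  rewrite enormZ gtr0_norm// -/k.
  by have := ler_wpM2r (ltW h0) e11; lra.
have th : enorm (ph (X u) - ph y) <= h * (enorm (psi p K y) + e1).
  rewrite -[ph (X u) - ph y](subrK (h *: psi p K y)).
  apply: (le_trans (enormD _ _)); rewrite enormZ gtr0_norm//; lra.
have un : enorm (X u) <= n + e1.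
  by have := enorm_sub (X u) y; rewrite -/n; lra.
have V1 : bilin (P (ph (X u)) - P (ph y)) (X u) (X u) <=
    h * (n ^+ 2 + e1 * (2 * n + 1 + LP * (n + 1) ^+ 2)).
  apply: (le_trans (variation_le _ Du Dt)).
  have s1 : enorm (X u) ^+ 2 <= (n + e1) ^+ 2.
    by rewrite ler_sqr ?nnegrE ?enorm_ge0//; lra.
  have s2 : LP * enorm (ph (X u) - ph y) <= h * (1 + e1 * LP).
    apply: (le_trans (ler_wpM2l (ltW LP0) th)).
    by have := ler_wpM2l (ltW h0) psi1; lra.
  apply: (@le_trans _ _ (h * (1 + e1 * LP) * (n + e1) ^+ 2)).
    by apply: ler_pM => //; rewrite ?sqr_ge0// mulr_ge0 ?enorm_ge0// ltW.
  rewrite -mulrA ler_pM2l//.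
  have s3 : (n + e1) ^+ 2 <= (n + 1) ^+ 2 by rewrite ler_sqr ?nnegrE; lra.
  have s4 := ler_wpM2l (ltW (mulr_gt0 e10 LP0)) s3.
  have s5 : e1 * e1 <= e1 by rewrite ler_piMr// ltW.
  by lra.
have V2 : bilin (P (ph y)) (X u) (X u) - bilin (P (ph y)) y y <=
    h * (- n ^+ 2 + e1 * (o * (2 * n + k + 1))).
  set r := X u - y - h *: f y in H1.
  rewrite (quad_expansion _ h y (f y)) -/r.
  have -> : bilin (P (ph y)) y (f y) + bilin (P (ph y)) (f y) y = - n ^+ 2.
    exact: (P_lyap _ (E_phi p Dt)).
  rewrite mulrDr lerD2l.
  have b1 : enorm r <= h * e1 by rewrite mulrC.
  have b2 : enorm y * enorm r <= n * (h * e1) by rewrite ler_wpM2l.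
  have b3 : enorm (X u - y) * enorm (X u - y) <= h * (k + 1) * e1.
    by rewrite ler_pM ?enorm_ge0.
  have := bilin_le (P (ph y)) y r; have := bilin_le (P (ph y)) r y.
  have := bilin_le (P (ph y)) (X u - y) (X u - y).
  rewrite [enorm r * _]mulrC -/o.
  have := ler_wpM2l o0 b2; have := ler_wpM2l o0 b3.
  by lra.
have := lerD V1 V2; rewrite -lyap_split => V3.
have := ler_wpM2l (ltW h0) e1e; rewrite /q; lra.
Unshelve. all: by end_near. Qed.

Lemma lyap_nonincreasing b X v : 0 <= b -> traj 0 b X v ->
  (forall t, 0 <= t -> t <= b -> D (X t)) ->
  (forall t, 0 <= t -> t < b -> v t = f (X t) /\ lyap (X t) < c) ->
  lyap (X b) <= lyap (X 0).
Proof.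
move=> b0 Xv XD Xf; apply: (@dini_nonincreasing _ (lyap \o X)) => //= t t0 tb e e0.
- have Ht := lyap_left Xv t0 tb (XD t (ltW t0) tb) e0.
  near=> s.
  have st : s < t by near: s; exact: nbhs_left_lt.
  have s0 : 0 <= s by near: s; exact: nbhs_left_ge.
  have Ds : D (X s) by apply: (XD s) => //; exact: le_trans (ltW st) tb.
  by move: Ds; near: s.
- have [vf Vc] := Xf t t0 tb; have Dt := XD t t0 (ltW tb).
  have [_ psiLP] := W_sub (E_phi p Dt) Vc.
  have psi1 : LP * enorm (psi p K (X t)) <= 1.
    by rewrite mulrC -ler_pdivlMr// mul1r ltW.
  have Ht := lyap_right Xv t0 tb vf Dt psi1 e0.
  near=> u.
  have tu : t < u by near: u; exact: nbhs_right_gt.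
  have ub : u <= b by near: u; exact: nbhs_right_le.
  have Du : D (X u) by apply: (XD u) => //; exact: le_trans t0 (ltW tu).
  by move: Du; near: u.
Unshelve. all: by end_near. Qed.

Variable h : R.
Hypotheses (h0 : 0 < h) (mh : m <= expR (l * h / 4)).
Hypothesis slow : forall x, D x -> enorm (psi p K x) < LP^-1 -> 0 < LA ->
  LA * enorm (psi p K x) <= l / (m * h).

(** theta = phi X has velocity psi X, so that slow is a bound on the velocity of
    A theta. *)
Lemma decay_in_domain b X v : 0 <= b -> traj 0 b X v ->
  (forall t, 0 <= t -> t < b -> [/\ v t = f (X t), D (X t) & lyap (X t) < c]) ->
  enorm (X b) <= m * expR (- (l / 4) * b) * enorm (X 0).
Proof.
move=> b0 Xv XP.
have Dt t : 0 <= t -> t < b -> D (X t) by move=> t0 tb; case: (XP t t0 tb).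
apply: (@slowly_varying_decay _ (A \o (ph \o X)) m l h b X) => //=.
- by move=> t t0 tb; exact/Aml/E_phi/Dt.
- have q0 : 0 <= l / (m * h) by rewrite divr_ge0 ?mulr_ge0 ?ltW.
  have [LA0|LA0] := leP LA 0.
    move=> s t s0 sb t0 tb.
    apply: (le_trans (ALA (E_phi p (Dt s s0 sb)) (E_phi p (Dt t t0 tb)))).
    apply: (@le_trans _ _ 0); last by rewrite mulr_ge0.
    by rewrite mulr_le0_ge0 ?enorm_ge0.
  have lip s t : 0 <= s -> s <= t -> t < b ->
      opnorm (A (ph (X s)) - A (ph (X t))) <= l / (m * h) * `|s - t| /\
      opnorm (A (ph (X t)) - A (ph (X s))) <= l / (m * h) * `|s - t|.
    move=> s0 st tb.
    have sb := le_lt_trans st tb; have t0 := le_trans s0 st.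
    have Xst : traj s t X v by apply: traj_sub Xv => //; exact: ltW.
    have psiq r : s <= r -> r < t -> enorm (dphi p (X r) (v r)) <= l / (m * h) / LA.
      move=> sr rt.
      have [vf Dr Vr] := XP r (le_trans s0 sr) (lt_trans rt tb).
      rewrite vf -psi_dphi ler_pdivlMr// mulrC; apply: slow => //.
      exact: (W_sub (E_phi p Dr) Vr).2.
    have := traj_lipschitz st (phi_traj p Xst) psiq; rewrite /= => phst.
    have LAst : LA * enorm (ph (X t) - ph (X s)) <= l / (m * h) * `|s - t|.
      rewrite distrC ger0_norm ?subr_ge0//.
      apply: (le_trans (ler_wpM2l (ltW LA0) phst)).
      by rewrite mulrA mulrCA mulfV ?gt_eqF// mulr1.
    split; apply: le_trans LAst; last by apply: ALA; apply: E_phi; exact: Dt.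
    by rewrite enormB; apply: ALA; apply: E_phi; exact: Dt.
  move=> s t s0 sb t0 tb; have [st|ts] := leP s t; first exact: (lip s t s0 st tb).1.
  by rewrite distrC; exact: (lip t s t0 (ltW ts) sb).2.
- by apply: (eq_traj _ Xv) => t t0 tb; case: (XP t t0 tb).
Qed.

(** A trajectory cannot leave the domain through its boundary: at a first exit
    time t the point X t still belongs to the open set of some W theta, theta
    being phi (X s) for s slightly before t. *)
Lemma trapped rho b X v : 0 <= b -> traj 0 b X v ->
  (forall t, 0 <= t -> t < b -> D (X t) -> enorm (X t) < rho -> v t = f (X t)) ->
  D (X 0) -> lyap (X 0) < c -> m * enorm (X 0) < rho ->
  forall t, 0 <= t -> t <= b -> D (X t) /\
    enorm (X t) < rho /\ enorm (X t) <= m * expR (- (l / 4) * t) * enorm (X 0).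
Proof.
move=> b0 Xv vf DX0 VX0 X0rho.
have rho0 : 0 < rho.
  by apply: le_lt_trans X0rho; rewrite mulr_ge0 ?enorm_ge0 ?ltW.
pose Q t := [/\ D (X t), lyap (X t) < c & enorm (X t) < rho].
have decay t : 0 <= t -> t <= b -> (forall s, 0 <= s -> s < t -> Q s) ->
    enorm (X t) < rho /\ enorm (X t) <= m * expR (- (l / 4) * t) * enorm (X 0).
  move=> t0 tb Qt.
  have xt : enorm (X t) <= m * expR (- (l / 4) * t) * enorm (X 0).
    apply: (@decay_in_domain t X v t0 (traj_sub (lexx _) tb Xv)) => s s0 st.
    have [Ds Vs Ns] := Qt s s0 st; split=> //.
    by apply: vf => //; exact: lt_le_trans tb.
  split=> //; apply: le_lt_trans X0rho; apply: (le_trans xt).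
  rewrite -mulrA ler_pM2l// ler_piMl ?enorm_ge0// -expR0 ler_expR.
  by rewrite mulNr oppr_le0 mulr_ge0// divr_ge0// ltW.
have noninc t : 0 <= t -> t <= b -> (forall s, 0 <= s -> s < t -> Q s) ->
    D (X t) -> lyap (X t) <= lyap (X 0).
  move=> t0 tb Qt Dt.
  apply: (@lyap_nonincreasing t X v t0 (traj_sub (lexx _) tb Xv)) => s s0.
    by rewrite le_eqVlt => /predU1P[->//|st]; case: (Qt s s0 st).
  move=> st; have [Ds Vs Ns] := Qt s s0 st; split=> //.
  by apply: vf => //; exact: lt_le_trans tb.
suff all t : 0 <= t -> t <= b -> Q t.
  move=> t t0 tb; have [Dt _ _] := all t t0 tb; split=> //; apply: (decay t) => //.
  by move=> s s0 st; apply: (all s) => //; exact: le_trans (ltW st) tb.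
apply: (@real_induction _ 0 b Q).
- by split=> //; apply: le_lt_trans X0rho; rewrite ler_peMl ?enorm_ge0.
- move=> {}t t0 tb Qt.
  have [Dt Vt Nt] := Qt t t0 (lexx t).
  have vft := vf t t0 tb Dt Nt.
  have [_ psiLP] := W_sub (E_phi p Dt) Vt.
  have psi1 : LP * enorm (psi p K (X t)) <= 1.
    by rewrite mulrC -ler_pdivlMr// mul1r ltW.
  pose q := opnorm (P (ph (X t))) * (2 * rho).
  have q0 : 0 <= q by rewrite !mulr_ge0 ?opnorm_ge0// ltW.
  pose e1 := Num.min ((rho - enorm (X t)) / 2) ((c - lyap (X t)) / (q + 1) / 2).
  have e10 : 0 < e1.
    by rewrite lt_min !divr_gt0// ?subr_gt0//; lra.
  have e1a : e1 <= (rho - enorm (X t)) / 2 by rewrite ge_min lexx.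
  have e1b : e1 * (q + 1) <= (c - lyap (X t)) / 2.
    have : e1 <= (c - lyap (X t)) / (q + 1) / 2 by rewrite ge_min lexx orbT.
    by rewrite mulrAC ler_pdivlMr//; lra.
  have Xc := traj_right_continuous Xv t0 tb e10.
  have Vr := lyap_right Xv t0 tb vft Dt psi1 (ltr01 : 0 < 1).
  near=> u.
  have tu : t < u by near: u; exact: nbhs_right_gt.
  have uc : u <= t + (c - lyap (X t)) / 2.
    by near: u; apply: nbhs_right_le; rewrite ltrDl divr_gt0// subr_gt0.
  have Xu : enorm (X u - X t) <= e1 by near: u.
  have Nu : enorm (X u) < rho by have := enorm_sub (X u) (X t); lra.
  have Du : D (X u).
    apply: (W_sub (E_phi p Dt) _).1.
    have := quad_diff (P (ph (X t))) (X u) (X t).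
    have : opnorm (P (ph (X t))) * (enorm (X u - X t) * (enorm (X u) + enorm (X t)))
       <= e1 * q.
      rewrite /q mulrCA ler_pM ?mulr_ge0 ?addr_ge0 ?enorm_ge0 ?opnorm_ge0//.
      by rewrite ler_wpM2l ?opnorm_ge0//; lra.
    by have := ltW e10; have := e1b; have := Vt; rewrite /lyap; lra.
  split=> //.
  have Vu : D (X u) -> lyap (X u) <= lyap (X t) + 1 * (u - t) by near: u.
  by have := Vu Du; lra.
- move=> {}t t0 tb Qt.
  have [Nt _] := decay t (ltW t0) tb Qt.
  suff Dt : D (X t).
    by split=> //; apply: le_lt_trans VX0; apply: noninc => //; exact: ltW.
  have [L L0 phL] := phi_lipschitz p (ltW rho0).
  pose q := (opnorm (P (ph 0)) + LP * (L * rho)) * (2 * rho).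
  have q0 : 0 <= q.
    by rewrite mulr_ge0 ?addr_ge0 ?mulr_ge0 ?opnorm_ge0 ?(ltW LP0) ?(ltW rho0).
  have e10 : 0 < (c - lyap (X 0)) / (q + 1) by rewrite divr_gt0 ?subr_gt0//; lra.
  have Xl := Xv.1 t t0 tb _ e10.
  have [s [st s0 Xst]] : exists s, [/\ s < t, 0 <= s &
      enorm (X s - X t) <= (c - lyap (X 0)) / (q + 1)].
    near (t^'-) => s; exists s; split; near: s => //.
      exact: nbhs_left_lt.
    exact: nbhs_left_ge.
  have [Ds Vs Ns] := Qt s s0 st.
  have Vs0 : lyap (X s) <= lyap (X 0).
    apply: noninc => //; first exact: le_trans (ltW st) tb.
    by move=> r r0 rs; apply: Qt => //; exact: lt_trans st.
  apply: (W_sub (E_phi p Ds) _).1.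
  have -> : bilin (P (ph (X s))) (X t) (X t) = lyap (X s) +
     (bilin (P (ph (X s)) - P (ph 0)) (X t) (X t) -
      bilin (P (ph (X s)) - P (ph 0)) (X s) (X s)) +
     (bilin (P (ph 0)) (X t) (X t) - bilin (P (ph 0)) (X s) (X s)).
    by rewrite /lyap !bilinBl; ring.
  have b1 := quad_diff (P (ph (X s)) - P (ph 0)) (X t) (X s).
  have b2 := quad_diff (P (ph 0)) (X t) (X s).
  have b3 : opnorm (P (ph (X s)) - P (ph 0)) <= LP * (L * rho).
    apply: (le_trans (PLP (E_phi p Ds) (E_phi p D0))); rewrite ler_pM2l//.
    have := phL (X s) 0 (ltW Ns); rewrite enorm0 subr0 => /(_ (ltW rho0)) h1.
    by apply: (le_trans h1); rewrite ler_wpM2l// ltW.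
  pose d := enorm (X t - X s) * (enorm (X t) + enorm (X s)).
  have d0 : 0 <= d by rewrite mulr_ge0 ?addr_ge0 ?enorm_ge0.
  have d1 : d <= enorm (X s - X t) * (2 * rho).
    by rewrite /d enormB ler_wpM2l ?enorm_ge0//; lra.
  have b4 := ler_wpM2r d0 b3.
  have b5 : (opnorm (P (ph 0)) + LP * (L * rho)) * d <= enorm (X s - X t) * q.
    rewrite /q [leRHS]mulrCA ler_wpM2l// addr_ge0 ?opnorm_ge0//.
    by rewrite mulr_ge0 ?(ltW LP0)// mulr_ge0// ltW.
  move: Xst; rewrite ler_pdivlMr; last lra.
  move: (enorm_ge0 (X s - X t)) b1 b2 b4 b5; rewrite -/d.
  set n := enorm (X s - X t); move=> n0 b1 b2 b4 b5 nq.
  have [n00|n00] := eqVneq n 0.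
    by move: b5; rewrite n00 mul0r; lra.
  have : 0 < n by rewrite lt_neqAle eq_sym n00.
  by lra.
Unshelve. all: by end_near. Qed.

(** The trajectories from x0 are confined to a bounded part S of D, where f
    coincides with a globally Lipschitz field k; existence and uniqueness for k
    then carry over to f. *)
Lemma attraction_domain_of_lyap x0 : D x0 -> lyap x0 < c ->
  attraction_domain f x0.
Proof.
move=> Dx0 Vx0.
pose rho := m * enorm x0 + 1.
have rho0 : 0 <= rho by rewrite addr_ge0// mulr_ge0 ?enorm_ge0 ?ltW.
have x0rho : m * enorm x0 < rho by rewrite ltrDl.
have [L L0 fL] := closed_loop_lipschitz D0 ALA rho0.
pose S : set 'cV[R]_2 := [set x | D x /\ enorm x <= rho].
have S0 : S 0 by split=> //; rewrite enorm0.
have fS z z' : S z -> S z' -> enorm (f z - f z') <= L * enorm (z - z').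
  by move=> [Dz Nz] [Dz' Nz']; exact: fL.
have [k [kf kL]] := lipschitz_field_extension S0 L0 fS.
have L1 : 0 < 2 * L + 1 by rewrite ltr_wpDl// mulr_ge0.
have kL1 z z' : enorm (k z - k z') <= (2 * L + 1) * enorm (z - z').
  by apply: (le_trans (kL z z')); rewrite ler_wpM2r ?enorm_ge0// lerDl.
have [X [X0 Xk]] := lipschitz_global_solution x0 L1 kL1.
have Xtraj b : traj 0 b X (k \o X) by apply: diff_at_traj => t t0 _; exact: Xk.
have XS t : 0 <= t -> D (X t) /\ enorm (X t) < rho /\
    enorm (X t) <= m * expR (- (l / 4) * t) * enorm (X 0).
  move=> t0; apply: (trapped t0 (Xtraj t)); rewrite ?X0//.
  by move=> s _ _ Ds Ns; apply: kf; split=> //; exact: ltW.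
exists X; split=> //.
- apply: diff_at_solution => t t0; have [Dt [Nt _]] := XS t t0.
  by rewrite -kf; [exact: Xk|split=> //; exact: ltW].
- have l4 : 0 < l / 4 by rewrite divr_gt0.
  have : enorm (X t) @[t --> +oo] --> (0 : R).
    apply: (@exp_decay_cvg0 _ _ (m * enorm x0) _ l4) => t t0.
    rewrite ger0_norm ?enorm_ge0//; have [_ [_]] := XS t t0.
    by rewrite X0 mulrAC.
  move=> /cvgrPdist_le X0'; apply/cvgrPdist_le => e e0.
  apply: filterS (X0' e e0) => t; rewrite !sub0r !normrN.
  by apply: le_trans; rewrite ger0_norm ?enorm_ge0// norm_le_enorm.
- move=> T y yf y0 t t0 tT.
  have ytraj := solution_traj yf tT.
  apply: (traj_unique t0 kL1 _ (Xtraj t)); last by rewrite y0.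
  apply: (eq_traj _ ytraj) => s s0 st /=.
  have [Ds [Ns _]] : D (y s) /\ enorm (y s) < rho /\
      enorm (y s) <= m * expR (- (l / 4) * s) * enorm (y 0).
    by apply: (trapped t0 ytraj) => //; rewrite ?y0//; exact: ltW.
  by rewrite kf//; split=> //; exact: ltW.
Qed.

End Attraction.

(** The constant of the slow variation condition: h = 4 ln m / l makes
    m = exp (l h / 4), and l / (m h) is then l^2 / (4 m ln m). For m = 1 every
    h > 0 satisfies m <= exp (l h / 4), and h = l LP / LA makes l / (m h) the
    bound LA / LP on LA r. *)
Lemma freezing_step (R : realType) (LA LP m l : R) (rates : set R) :
  1 <= m -> 0 < l -> 0 < LP ->
  (forall r, rates r -> r < LP^-1) ->
  (forall r, rates r -> 4 * LA * m * ln m != 0 ->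
     r < l ^+ 2 / (4 * LA * m * ln m)) ->
  exists h, [/\ 0 < h, m <= expR (l * h / 4) &
    forall r, rates r -> 0 < LA -> LA * r <= l / (m * h)].
Proof.
move=> m1 l0 LP0 rLP rslow.
have m0 : 0 < m by exact: lt_le_trans m1.
have lnm0 : 0 <= ln m by exact: ln_ge0.
have [LA0|LA0] := leP LA 0.
  exists (4 * ln m / l + 1); split.
  - by rewrite ltr_wpDl// divr_ge0 ?mulr_ge0// ltW.
  - have -> : l * (4 * ln m / l + 1) / 4 = ln m + l / 4 by field; rewrite gt_eqF.
    by rewrite expRD lnK// ler_peMr ?(ltW m0)// -expR0 ler_expR divr_ge0// ltW.
  - by [].
move: m1; rewrite le_eqVlt => /predU1P[m1|m1].
  exists (l * LP / LA); split.
  - by rewrite divr_gt0// mulr_gt0.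
  - by rewrite -m1 -expR0 ler_expR divr_ge0// mulr_ge0 ?divr_ge0 ?mulr_ge0// ltW.
  - move=> r rr _; have -> : l / (m * (l * LP / LA)) = LA * LP^-1.
      by rewrite -m1; field; rewrite !gt_eqF.
    by rewrite ler_pM2l// ltW// rLP.
have lnm : 0 < ln m by rewrite ln_gt0.
exists (4 * ln m / l); split; first by rewrite divr_gt0// mulr_gt0.
  have -> : l * (4 * ln m / l) / 4 = ln m by field; rewrite gt_eqF.
  by rewrite lnK.
move=> r rr _.
have nz : 0 < 4 * LA * m * ln m by rewrite !mulr_gt0.
have := rslow r rr (lt0r_neq0 nz) => /ltW h.
apply: (le_trans (ler_wpM2l (ltW LA0) h)).
by rewrite le_eqVlt; apply/orP; left; apply/eqP; field; rewrite !gt_eqF.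
Qed.

Theorem theorem5 (R : realType) (p : missile R) (lambda0 : R)
    (g : generic_constants R) (ord : {perm 'I_6})
    (s : 'cV[R]_2 -> mpoly.mpoly 5 R) (eta : 'cV[R]_2 -> {poly R})
    (rho : 'cV[R]_2 -> 'I_5 -> {poly R}) (tbar : 'cV[R]_2 -> R)
    (D : set 'cV[R]_2) (LA m lambda : R) :
  let K := fun theta => (rho theta 0).[tbar theta] in
  let E := theta_set p D in
  let F := rate_set p K D in
  let f := closed_loop p K in
  0 < lambda0 ->
  ord ord_max = ord_max ->
  (forall theta, E theta ->
     gain_polynomials p lambda0 g theta ord (s theta) (eta theta) (rho theta)) ->
  (forall theta, E theta -> (eta theta).[tbar theta] = 0) ->
  D 0 ->
  (forall theta theta', E theta -> E theta' ->
     opnorm (Acl p K theta - Acl p K theta') <= LA * enorm (theta - theta')) ->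
  1 <= m -> 0 < lambda ->
  (forall theta, E theta ->
     forall x, solution (fun y => Acl p K theta *m y) +oo%E x ->
     forall t, 0 <= t ->
       enorm (x t) <= m * expR (- lambda * t) * enorm (x 0)) ->
  (* the bound is infinite when its denominator vanishes, e.g. for m = 1 *)
  (forall omega, F omega -> 4 * LA * m * ln m != 0 ->
     enorm omega < lambda ^+ 2 / (4 * LA * m * ln m)) ->
  (nbhs (0 : 'cV[R]_2) D -> exp_stable f) /\
  (forall LP c : R, 0 < LP ->
     (forall theta theta', E theta -> E theta' ->
        opnorm (Plyap p K theta - Plyap p K theta') <=
          LP * enorm (theta - theta')) ->
     largest_level p K D LP c ->
     [/\ exp_stable f, Lset p K D c `<=` D &
         Lset p K D c `<=` attraction_domain f]).
Proof.
move=> K E F f _ _ _ _ D0 ALA m1 l0 stable rates.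
have Aml theta : E theta -> decays (Acl p K theta) m lambda.
  move=> Eth v t t0.
  have := stable theta Eth _ (@mexp_solution _ (Acl p K theta) v) t t0.
  by rewrite scale0r mexp0.
split.
  move=> /nbhs_ballP[r /= r0 rD].
  apply: (closed_loop_exp_stable D0 ALA m1 l0 Aml r0) => x xr; apply: rD.
  rewrite mx_norm_ball /ball_/= sub0r normrN.
  exact: le_lt_trans (norm_le_enorm x) xr.
move=> LP c LP0 PLP [c0 Wc _].
have P_lyap theta x : E theta ->
    bilin (Plyap p K theta) x (Acl p K theta *m x) +
    bilin (Plyap p K theta) (Acl p K theta *m x) x = - enorm x ^+ 2.
  move=> Eth.
  exact: (gramian_lyapunov (Acl01 _ _ _) (Acl11 _ _ _) l0 (Aml _ Eth)).
have W_sub theta x : E theta -> bilin (Plyap p K theta) x x < c ->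
    D x /\ enorm (psi p K x) < LP^-1.
  by move=> Eth xW; exact: (Wc theta Eth x xW).
have [r r0 rD] := D_nbhs D0 c0 W_sub.
have LD : Lset p K D c `<=` D.
  by move=> x xL; apply: (W_sub (phi p 0) x _ _).1; [exact: E_phi|
    apply: xL; exact: E_phi].
split=> //; first exact: (closed_loop_exp_stable D0 ALA m1 l0 Aml r0 rD).
have [||h [h0 mh slow]] := @freezing_step R LA LP m lambda
  [set w | exists x, [/\ D x, enorm (psi p K x) < LP^-1 & w = enorm (psi p K x)]]
  m1 l0 LP0.
- by move=> _ [x [_ xLP ->]].
- by move=> _ [x [Dx _ ->]]; apply: rates; exists x.
have slow' x : D x -> enorm (psi p K x) < LP^-1 -> 0 < LA ->
    LA * enorm (psi p K x) <= lambda / (m * h).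
  by move=> Dx xLP; apply: slow; exists x.
move=> x xL; have Dx := LD x xL.
have Vx : lyap p (Plyap p K) x < c by apply: xL; exact: E_phi.
exact (attraction_domain_of_lyap D0 ALA m1 l0 Aml LP0 PLP P_lyap W_sub h0 mh
  slow' Dx Vx).
Qed.
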